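(* Let $R$ be a commutative ring, let $A$ be an $R$-algebra and let $\{\sigma_i\}_{i\in I}$ be a system of $R$-involutions on $A$. Assume that $R$ is local and henselian, $2\in R^\times$, and at least one of the following holds: (1) $R$ is noetherian and $A$ is finitely generated as an $R$-module. (2) $R$ is a valuation ring, and $A$ is $R$-torsion-free of finite rank. Then systems of (not necessarily unimodular) sesquilinear forms over $(A,\{\sigma_i\}_{i\in I})$, defined on finitely generated projective right $A$-modules, cancel from orthogonal sums; that is, if $(P,\{s_i\})$, $(Q,\{t_i\})$, $(Q',\{t'_i\})$ are such systems and $(P,\{s_i\})\perp(Q,\{t_i\})\cong(P,\{s_i\})\perp(Q',\{t'_i\})$, then $(Q,\{t_i\})\cong(Q',\{t'_i\})$.
   Context: An $R$-involution on $A$ is an $R$-linear anti-automorphism $\sigma$ of $A$ with $\sigma^2=\mathrm{id}_A$. A system of sesquilinear forms over $(A,\{\sigma_i\}_{i\in I})$ is a pair $(P,\{s_i\}_{i\in I})$ where $P$ is a finitely generated projective right $A$-module and each $s_i:P\times P\to A$ is biadditive with $s_i(xa,yb)=a^{\sigma_i}s_i(x,y)b$ for all $x,y\in P$, $a,b\in A$ (no symmetry or nondegeneracy is assumed). An isometry $(P,\{s_i\})\to(P',\{s'_i\})$ is an $A$-isomorphism $\psi:P\to P'$ with $s'_i(\psi x,\psi y)=s_i(x,y)$ for all $i\in I$ and $x,y\in P$; $\cong$ means that an isometry exists. The orthogonal sum is $(P,\{s_i\})\perp(Q,\{t_i\})=(P\oplus Q,\{s_i\perp t_i\})$ with $(s_i\perp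 t_i)(x\oplus y,x'\oplus y')=s_i(x,x')+t_i(y,y')$. For an integral domain $R$ with fraction field $K$, the rank of an $R$-module $M$ is $\dim_KM\otimes_RK$. *)

(* Defs.v *)
From HB Require Import structures.
From mathcomp Require Import all_boot all_order all_algebra.
From mathcomp Require Import classical_sets.

Set Implicit Arguments.
Unset Strict Implicit.
Unset Printing Implicit Defensive.

Import GRing.Theory.
Local Open Scope classical_set_scope.
Local Open Scope ring_scope.

Definition is_ideal (R : comUnitRingType) (J : set R) : Prop :=
  J 0 /\ forall a u v, J u -> J v -> J (a * u + v).

Definition maximal_ideal (R : comUnitRingType) (m : set R) : Prop :=
  [/\ is_ideal m, ~ m 1
    & forall J : set R, is_ideal J -> ~ J 1 -> m `<=` J -> J = m].

Definition local_ring (R : comUnitRingType) : Prop :=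
  exists! m : set R, maximal_ideal m.

(* Simple roots modulo the maximal ideal lift to roots: the conditions on [a]
   say that its class in the residue field is a root of the reduction of [f]
   but not of the derivative of that reduction.  To be used for local [R]. *)
Definition henselian (R : comUnitRingType) : Prop :=
  forall m : set R, maximal_ideal m ->
  forall (f : {poly R}) (a : R), f \is monic ->
    m f.[a] -> ~ m f^`().[a] -> exists b : R, f.[b] = 0 /\ m (b - a).

Definition noetherian (R : comUnitRingType) : Prop :=
  forall J : set R, is_ideal J ->
  exists (n : nat) (g : 'I_n -> R),
    forall x, J x <-> exists c : 'I_n -> R, x = \sum_i c i * g i.

(* Modules are left modules over an arbitrary ring [S]; right [A]-modules are
   the case [S = A^c], where [(a : A^c) *: x] is the right action [x a]. *)
Definition fin_gen (S : pzRingType) (M : lmodType S) : Prop :=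
  exists (n : nat) (g : 'I_n -> M),
    forall x, exists c : 'I_n -> S, x = \sum_i c i *: g i.

Definition projective (S : pzRingType) (P : lmodType S) : Prop :=
  forall (M N : lmodType S) (p : {linear M -> N}) (f : {linear P -> N}),
    (forall y, exists x, p x = y) ->
    exists h : {linear P -> M}, forall x, p (h x) = f x.

Definition torsion_free (R : comUnitRingType) (M : lmodType R) : Prop :=
  forall (r : R) (x : M), r *: x = 0 -> r = 0 \/ x = 0.

(* [iota] exhibits [K] as the fraction field of [R]; this forces [R] to be an
   integral domain. *)
Definition is_fraction_field (R : comUnitRingType) (K : fieldType)
    (iota : {rmorphism R -> K}) : Prop :=
  injective iota /\
  forall x : K, exists a b : R, iota b != 0 /\ x = iota a / iota b.

Definition valuation_ring (R : comUnitRingType) : Prop :=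
  exists (K : fieldType) (iota : {rmorphism R -> K}),
    is_fraction_field iota /\
    forall x : K, x != 0 ->
      (exists r : R, x = iota r) \/ (exists r : R, x^-1 = iota r).

(* The universal property of [x |-> x (x) 1 : M -> M (x)_R K]: [j] is
   [R]-linear along [iota], and universal for such maps into [K]-spaces. *)
Definition is_base_change (R : comUnitRingType) (K : fieldType)
    (iota : {rmorphism R -> K}) (M : lmodType R) (V : lmodType K)
    (j : {linear M -> V | iota \; *:%R}) : Prop :=
  forall (W : lmodType K) (f : {linear M -> W | iota \; *:%R}),
    exists g : {linear V -> W},
      (forall x, g (j x) = f x) /\
      forall g' : {linear V -> W}, (forall x, g' (j x) = f x) -> g' =1 g.

Definition has_rank (R : comUnitRingType) (M : lmodType R) (n : nat) : Prop :=
  exists (K : fieldType) (iota : {rmorphism R -> K}),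
    is_fraction_field iota /\
    exists (V : vectType K) (j : {linear M -> V | iota \; *:%R}),
      is_base_change j /\ \dim {:V} = n.

Definition finite_rank (R : comUnitRingType) (M : lmodType R) : Prop :=
  exists n : nat, has_rank M n.

Definition R_involution (R : comUnitRingType) (A : algType R)
    (sigma : A -> A) : Prop :=
  [/\ linear sigma, sigma 1 = 1,
      forall a b, sigma (a * b) = sigma b * sigma a
    & forall a, sigma (sigma a) = a].

Definition sesquilinear (A : pzRingType) (sigma : A -> A) (P : lmodType A^c)
    (s : P -> P -> A) : Prop :=
  [/\ forall x x' y, s (x + x') y = s x y + s x' y,
      forall x y y', s x (y + y') = s x y + s x y'
    & forall (x y : P) (a b : A),
        s ((a : A^c) *: x) ((b : A^c) *: y) = sigma a * s x y * b].

Definition sesq_system (A : pzRingType) (I : Type) (sigma : I -> A -> A)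
    (P : lmodType A^c) (s : I -> P -> P -> A) : Prop :=
  [/\ fin_gen P, projective P & forall i, sesquilinear (sigma i) (s i)].

Definition orth_sum (A : pzRingType) (I : Type) (P Q : lmodType A^c)
    (s : I -> P -> P -> A) (t : I -> Q -> Q -> A) :
    I -> (P * Q)%type -> (P * Q)%type -> A :=
  fun i u v => s i u.1 v.1 + t i u.2 v.2.

Definition isometric (A : pzRingType) (I : Type) (P P' : lmodType A^c)
    (s : I -> P -> P -> A) (s' : I -> P' -> P' -> A) : Prop :=
  exists psi : {linear P -> P'},
    bijective psi /\ forall i x y, s' i (psi x) (psi y) = s i x y.

(* Main.v *)
Require Import Defs.
From HB Require Import structures.
From mathcomp Require Import all_boot all_order all_algebra perm.
From mathcomp Require Import ring_quotient qpoly ring.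
From mathcomp.multinomials Require Import mpoly.
From mathcomp.classical Require Import boolp.
From mathcomp.classical Require classical_sets.
Import GRing.Theory.
Local Open Scope ring_scope.
Set Implicit Arguments.
Unset Strict Implicit.
Unset Printing Implicit Defensive.

(** Why cancellation holds. Let M = P + Q with the system of forms h, and let E
    be the ring of pairs (f, g) of endomorphisms of M which are mutually adjoint
    for all the forms, with the involution that exchanges f and g. An adjoint is
    kept as a datum, so nothing is asked of the forms. Let e in E be the
    projection onto P. An isometry psi from P + Q to P + Q' provides u in E, which
    sends (p, q) to psi^-1 (p, 0) and satisfies u^* u = e and u e = u. If some
    unitary t of E extends u, in the sense that t e = u, then psi t is an
    isometry that restricts to one from Q to Q'. So it suffices to prove Witt's
    extension property for the symmetric idempotent e of E.

    This property is additive on orthogonal symmetric idempotents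
    ([witt_extensionD]), and E has no infinite family of nonzero ones, so one may
    assume that e is minimal ([symmetric_idempotent_witt]). Each a in E satisfies
    p(a) = 0 for a primitive polynomial p. Over the henselian ring R this implies
    that the algebra generated by a has an idempotent which splits it into a part
    where a is invertible and one where 1 - a is ([primitive_splitting]). For
    symmetric a in the corner ring of a minimal e there is no room for both parts:
    a or 1 - a is invertible ([minimal_dichotomy]). As 2 is invertible, symmetric
    elements which are not invertible then belong to the Jacobson radical
    ([symmetric_nonunit_radical]), and e can be moved to u, as in Witt's classical
    proof, by one or two reflections ([minimal_witt_extension]). Since neither
    v^* v nor 1 - b, for b = e u, has to be invertible, these are
    quasi-reflections 1 - v r^-1 v^* in which r + r^* = v^* v but r need not be
    symmetric.

    The splitting rests on the lifting of coprime factorizations from the residue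
    field ([hensel_factor]), which is derived from the lifting of simple roots by
    means of symmetric functions of the roots. A change of variable reduces
    primitive relations to monic ones ([primitive_to_integral]).

    It remains to find the primitive relations and to bound the orthogonal
    idempotents. If A is finitely generated over R, so is M: use the
    Cayley-Hamilton theorem and Nakayama's lemma. If A is torsion-free of finite
    rank over a valuation ring with fraction field K, then E embeds in a
    finite-dimensional vector space over K: use linear dependence, and divide each
    relation by a coefficient of least valuation. *)

(** * Maximal submodules and the residue field *)

Section Zorn.
Import classical_sets.
Local Open Scope classical_set_scope.

(** Zorn's lemma for a class of nonempty sets, where only nonempty chains need
    an upper bound. *)
Lemma Zorn_maximal (T : Type) (Q : set (set T)) (A : set T) : Q A ->
  (forall B, Q B -> B !=set0) ->
  (forall F : set (set T), F `<=` Q -> F !=set0 -> total_on F subset ->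
     Q (\bigcup_(X in F) X)) ->
  exists2 B, Q B & forall C, Q C -> B `<=` C -> C `<=` B.
Proof.
move=> QA Qn0 Qchain.
have [F FP Ftot|B [PB Bmax]] := @Zorn_bigcup T (fun B => B = set0 \/ Q B).
  pose F' := [set X | F X /\ Q X].
  have [F'0|F'n0] := pselect (F' !=set0); last first.
    left; apply/seteqP; split=> // y [X FX Xy]; apply: F'n0; exists X; split=> //.
    by case: (FP X FX) Xy => [->//|].
  right; suff -> : \bigcup_(X in F) X = \bigcup_(X in F') X.
    apply: Qchain => //; first by move=> X [].
    by move=> X Y [FX _] [FY _]; apply: Ftot.
  apply/seteqP; split=> y [X]; last by case=> FX _ Xy; exists X.
  move=> FX Xy; exists X => //; split=> //.
  by case: (FP X FX) Xy => [->//|].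
have QB : Q B.
  case: PB => // B0; have [y Ay] := Qn0 A QA.
  case: (Bmax A); last by right.
  by rewrite B0; split=> // sub; have := sub y Ay.
exists B => // C QC BC; apply: contrapT => CB.
by apply: (Bmax C); [split|right].
Qed.
End Zorn.

Section LocalRings.
Import classical_sets.
Local Open Scope classical_set_scope.
Variable R : comUnitRingType.
Implicit Types (J m : set R) (x : R).

Lemma ideal_mul J a x : is_ideal J -> J x -> J (a * x).
Proof. by move=> [J0 JD] Jx; rewrite -[_ * _]addr0; apply: JD. Qed.

Lemma nonunit_in_maximal x : x \isn't a GRing.unit ->
  exists2 m : set R, maximal_ideal m & m x.
Proof.
move=> xNU; pose Q J := [/\ is_ideal J, ~ J 1 & J x].
have Qx : Q [set y | exists a, y = a * x].
  split; last by exists 1; rewrite mul1r.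
    split; first by exists 0; rewrite mul0r.
    by move=> a _ _ [b ->] [c ->]; exists (a * b + c); rewrite mulrDl mulrA.
  move=> [a ax]; move/negP: xNU; apply; apply/unitrPr; exists a.
  by rewrite mulrC.
have [||M [MI M1 Mx] Mmax] := @Zorn_maximal R Q _ Qx.
- by move=> J [_ _ Jx]; exists x.
- move=> F FQ [X0 FX0] Ftot; split; last by exists X0 => //; case: (FQ X0 FX0).
    split; first by exists X0 => //; case: (FQ X0 FX0) => [[]].
    move=> a u v [X FX Xu] [Y FY Yv].
    have [[[_ XI] _ _] [[_ YI] _ _]] := (FQ X FX, FQ Y FY).
    case: (Ftot X Y FX FY) => sub; first by exists Y => //; apply: YI => //; apply: sub.
    by exists X => //; apply: XI => //; apply: sub.
  by move=> [X FX]; case: (FQ X FX).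
exists M => //; split=> // J JI J1 MJ; apply/seteqP; split=> //.
by apply: Mmax => //; split=> //; apply: MJ.
Qed.

(** The residue field, with the two ways in which it controls a henselian
    local ring: it detects units, and simple roots lift from it. *)
Lemma henselian_residue_field : local_ring R -> henselian R ->
  exists (k : fieldType) (pi : {rmorphism R -> k}),
  [/\ forall y, exists x, pi x = y,
      forall x, (x \is a GRing.unit) = (pi x != 0)
    & forall (f : {poly R}) a, f \is monic -> pi f.[a] = 0 ->
        pi f^`().[a] != 0 -> exists2 b, f.[b] = 0 & pi b = pi a].
Proof.
move=> [m [mM muniq]] hens; have [mI m1 mmax] := mM.
have nonunit x : x \isn't a GRing.unit -> m x.
  by move=> /nonunit_in_maximal[n nM nx]; rewrite (muniq n nM).
have unit x : x \is a GRing.unit -> ~ m x.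
  by move=> xU mx; apply: m1; rewrite -(mulVr xU); apply: ideal_mul.
pose I : {pred R} := fun x => `[< m x >].
have IE x : (x \in I) = `[< m x >] by [].
have IC : idealr_closed I.
  split; first by rewrite IE; apply/asboolP; case: mI.
    by rewrite IE; apply/asboolP.
  by move=> a u v; rewrite !IE => /asboolP mu /asboolP mv; apply/asboolP/mI.2.
pose IP := isIdealr.Build R I IC.
pose Im : idealr R := HB.pack I IP.
pose Q : comNzRingType := {ideal_quot Im}.
pose p : {rmorphism R -> Q} := \pi_Q%qT.
have pE x : (p x == 0) = `[< m x >].
  by rewrite -[0](rmorph0 p) -Quotient.idealrBE subr0.
have pS y : exists x, p x = y by exists (repr y); apply: reprK.
have exV (y : Q) : exists z, (y != 0) ==> (z * y == 1).
  have [x <-] := pS y; exists (p x^-1); apply/implyP; rewrite pE => /asboolP mx.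
  by rewrite -rmorphM mulVr ?rmorph1 //; apply/negPn/negP => /nonunit/mx.
pose iv (y : Q) := if y == 0 then 0 else xchoose (exV y).
have ivK (x : Q) : x != 0 -> iv x * x = 1.
  move=> x0; rewrite /iv ifN //; apply/eqP.
  exact: (implyP (xchooseP (exV x))).
have iv0 : iv 0 = 0 by apply: ifT.
pose kM := GRing.ComNzRing_isField.Build Q ivK iv0.
pose k : fieldType := HB.pack Q kM.
exists k, p; split=> //.
  move=> x; rewrite pE; apply/idP/idP; first by move/unit/asboolPn.
  by move/asboolPn => mx; apply/negPn/negP => /nonunit/mx.
move=> f a fM /eqP; rewrite pE => /asboolP fa; rewrite pE => /asboolPn f'a.
have [b [fb mba]] := hens m mM f a fM fa f'a.
exists b => //; apply/eqP; rewrite -subr_eq0 -rmorphB pE; exact/asboolP.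
Qed.

End LocalRings.

(** * Factorization over a henselian local ring *)

(** A root is adjoined by passing to B[X]/(P), where division by the monic P
    shows that constants inject, whatever the base ring. *)
Lemma splitting_ring n (B : comNzRingType) (P : {poly B}) :
  P \is monic -> size P = n.+1 ->
  exists (U : comNzRingType) (iota : {rmorphism B -> U}) (s : seq U),
  [/\ injective iota, size s = n
    & map_poly iota P = \prod_(a <- s) ('X - a%:P)].
Proof.
elim: n B P => [|n IHn] B P PM sP.
  exists B, idfun, [::]; split=> //.
  have /size_poly1P[c c0 Pc] : size P == 1%N by rewrite sP.
  rewrite big_nil map_poly_id // Pc; move/monicP: PM.
  by rewrite Pc lead_coefC => ->.
pose jj : {rmorphism B -> {poly %/ P}} := qpolyC P.
have mkP : mk_monic P = P by rewrite /mk_monic sP PM.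
have jjI : injective jj.
  by move=> a b /(congr1 (fun p : {poly %/ P} => (p : {poly B})`_0)) /=; rewrite !coefC.
have rootX : root (map_poly jj P) (in_qpoly P 'X).
  have -> : map_poly jj P = map_poly (in_qpoly P) (map_poly polyC P).
    rewrite -map_poly_comp; apply: eq_map_poly => a /=.
    apply/val_inj; rewrite /= mkP Pdiv.CommonRing.rmodp_small // sP.
    by rewrite ltnS (leq_trans (size_polyC_leq1 a)).
  apply/eqP; rewrite horner_map/= -[_.['X]]/(P \Po 'X) comp_polyXr.
  by apply/val_inj; rewrite /= mkP Pdiv.RingMonic.rmodpp.
have /factor_theorem[Q PQ] := rootX.
have jPM : map_poly jj P \is monic by rewrite monicE (lead_coef_map_inj jjI (rmorph0 _)) (monicP PM) rmorph1.
have QM : Q \is monic by move: jPM; rewrite PQ monicMr ?monicXsubC.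
have sQ : size Q = n.+1.
  have := size_map_inj_poly jjI (rmorph0 _) P; rewrite sP PQ.
  by rewrite size_Mmonic ?monicXsubC ?monic_neq0 // size_XsubC addn2 => -[].
have [U [iota [s [iI ss sE]]]] := IHn _ Q QM sQ.
exists U, (iota \o jj), (iota (in_qpoly P 'X) :: s); split.
- exact: inj_comp iI jjI.
- by rewrite /= ss.
by rewrite map_poly_comp PQ rmorphM /= sE big_cons map_polyXsubC mulrC.
Qed.

Lemma coef_prod_roots (U : comNzRingType) n (x : 'I_n -> U) (k : nat) :
  (k <= n)%N ->
  (\prod_i ('X - (x i)%:P))`_(n - k) =
    (-1) ^+ k * \sum_(I : {set 'I_n} | #|I| == k) \prod_(i in I) x i.
Proof.
move=> kn; have <- : \prod_(a <- codom x) ('X - a%:P) = \prod_i ('X - (x i)%:P).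
  by rewrite big_image.
pose s := codom x; have ss : size s = n by rewrite size_codom card_ord.
rewrite coef_prod_XsubC -/s ss ?leq_subr // subKn //; congr (_ * _).
apply: eq_bigr => I _; apply: eq_bigr => i _.
by rewrite (nth_map i) ?size_enum_ord // nth_ord_enum.
Qed.

(** A symmetric function of the roots is a polynomial in the coefficients of P.
    The same [d] serves every ring [U] in which P splits: this allows one to
    compare the roots of P with those of its reduction. *)
Lemma symmetric_descent (B : comNzRingType) n (f : {mpoly B[n]}) (P : {poly B}) :
  f \is symmetric ->
  exists d : B, forall (U : comNzRingType) (psi : {rmorphism B -> U})
    (x : 'I_n -> U), map_poly psi P = \prod_i ('X - (x i)%:P) ->
    psi d = mmap psi x f.
Proof.
move=> /sym_fundamental[F [<- _]].
pose c (i : 'I_n) := (-1) ^+ i.+1 * P`_(n - i.+1).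
exists F.@[c] => U psi x Px.
have cE i : psi (c i) = mmap psi x (mesym n B i.+1).
  rewrite /c rmorphM rmorphXn rmorphN1 -coef_map Px coef_prod_roots //.
  rewrite mulrA -exprD addnn -signr_odd odd_double mul1r /mesym rmorph_sum.
  apply: eq_bigr => I _; rewrite rmorph_prod; apply: eq_bigr => j _ /=.
  by rewrite mmapX mmap1U.
rewrite [F]mpolyE.
rewrite (raddf_sum (meval c)) (rmorph_sum psi) (raddf_sum (comp_mpoly _)) (raddf_sum (mmap psi x)).
apply: eq_bigr => m _; rewrite /= mevalZ comp_mpolyZ rmorphM mmapZ; congr (_ * _).
rewrite mevalX comp_mpolyX !rmorph_prod; apply: eq_bigr => i _ /=.
by rewrite !rmorphXn /= cE tnth_mktuple.
Qed.

(** Candidate factors of degree r of a polynomial with roots x_i are indexed by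
    the r-element sets S of indices, and labelled by the products y_S of the
    x_i with i in S. If [t] is one of the labels, the weights
    prod_(S' <> S) (t - y_S') vanish on all the other sets, in the manner of
    Lagrange interpolation: [subset_sum] then selects one factor (or with
    f = complement its cofactor) by a formula symmetric in the roots. *)
Section SubsetProducts.
Variables (n r : nat).
Implicit Types (U : comNzRingType) (S : {set 'I_n}).

Definition subset_poly U (x : 'I_n -> U) (t : U) : U :=
  \prod_(S : {set 'I_n} | #|S| == r) (t - \prod_(i in S) x i).

Definition subset_coprod U (x : 'I_n -> U) (t : U) S : U :=
  \prod_(S' : {set 'I_n} | (#|S'| == r) && (S' != S)) (t - \prod_(i in S') x i).

Definition subset_sum (f : {set 'I_n} -> {set 'I_n}) U (x : 'I_n -> U) (t z : U) : U :=
  \sum_(S : {set 'I_n} | #|S| == r)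
    (\prod_(i in f S) (z - x i)) * subset_coprod x t S.

Section Morphism.
Variables (U V : comNzRingType) (phi : {rmorphism U -> V}).
Variables (x : 'I_n -> U) (y : 'I_n -> V).
Hypothesis phi_x : forall i, phi (x i) = y i.

Lemma subset_poly_morph t : phi (subset_poly x t) = subset_poly y (phi t).
Proof.
rewrite rmorph_prod; apply: eq_bigr => S _; rewrite rmorphB rmorph_prod.
by congr (_ - _); apply: eq_bigr.
Qed.

Lemma subset_sum_morph f t z :
  phi (subset_sum f x t z) = subset_sum f y (phi t) (phi z).
Proof.
rewrite rmorph_sum; apply: eq_bigr => S _; rewrite rmorphM !rmorph_prod.
congr (_ * _); apply: eq_bigr => i _; rewrite rmorphB ?phi_x //.
by congr (_ - _); rewrite rmorph_prod; apply: eq_bigr.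
Qed.

End Morphism.

Section Symmetry.
Variables (U : comNzRingType) (x : 'I_n -> U) (s : 'S_n).

Let prod_perm S : \prod_(i in S) x (s i) = \prod_(i in s @: S) x i.
Proof. by rewrite big_imset // => i j _ _; apply: perm_inj. Qed.

Let card_perm S : #|s @: S| = #|S|.
Proof. by rewrite card_imset //; apply: perm_inj. Qed.

Let bij_perm : {on [pred S : {set 'I_n} | #|S| == r], bijective (fun S => s @: S)}.
Proof.
apply: onW_bij; exists (fun S => (s^-1)%g @: S) => S; rewrite -imset_comp.
  by rewrite (eq_imset (g := id)) ?imset_id // => i /=; rewrite permK.
by rewrite (eq_imset (g := id)) ?imset_id // => i /=; rewrite permKV.
Qed.

Lemma subset_poly_perm t : subset_poly (x \o s) t = subset_poly x t.
Proof.
rewrite /subset_poly [RHS](reindex (fun S => s @: S)) //.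
by apply: eq_big => [S|S _]; rewrite ?card_perm //= prod_perm.
Qed.

Lemma subset_sum_perm (f : {set 'I_n} -> {set 'I_n}) t z : (forall S, f (s @: S) = s @: f S) ->
  subset_sum f (x \o s) t z = subset_sum f x t z.
Proof.
move=> fs; rewrite /subset_sum [RHS](reindex (fun S => s @: S)) //=.
apply: eq_big => [S|S _]; first by rewrite card_perm.
congr (_ * _).
  by rewrite fs big_imset // => i j _ _; apply: perm_inj.
rewrite /subset_coprod [RHS](reindex (fun S => s @: S)) /=; last first.
  by case: bij_perm => g h1 h2; exists g => S' /andP[S'r _]; [apply: h1|apply: h2].
apply: eq_big => [S'|S' _]; last by rewrite /= prod_perm.
by rewrite card_perm (inj_eq (imset_inj (@perm_inj _ s))).
Qed.

End Symmetry.

Lemma subset_poly_symmetric (B : comNzRingType) (t : B) :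
  subset_poly (fun i => 'X_i) t%:MP \is @symmetric n B.
Proof.
apply/issymP => s.
rewrite (@subset_poly_morph _ _ (msym s) _ (fun i => 'X_(s i))); last first.
  by move=> i /=; rewrite /msym mmapX mmap1U.
by rewrite /= /msym mmapC -[RHS](subset_poly_perm _ s).
Qed.

Lemma subset_sum_symmetric (f : {set 'I_n} -> {set 'I_n}) (B : comNzRingType) (t z : B) :
  (forall (s : 'S_n) (S : {set 'I_n}), f (s @: S) = s @: f S) ->
  subset_sum f (fun i => 'X_i) t%:MP z%:MP \is @symmetric n B.
Proof.
move=> fs; apply/issymP => s.
rewrite (@subset_sum_morph _ _ (msym s) _ (fun i => 'X_(s i))); last first.
  by move=> i /=; rewrite /msym mmapX mmap1U.
by rewrite /= /msym !mmapC -[RHS](@subset_sum_perm _ _ s).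
Qed.

(** Two weights with different indices multiply to a multiple of
    [subset_poly x t], which is zero; only the diagonal terms of the product
    survive. *)
Lemma subset_sumM U (x : 'I_n -> U) t z : subset_poly x t = 0 ->
  subset_sum id x t z * subset_sum (@setC _) x t z =
    subset_sum (fun=> set0) x t z ^+ 2 * \prod_i (z - x i).
Proof.
move=> phi0; pose c := subset_coprod x t.
have c0 S S' : #|S| == r -> S' != S -> c S * c S' = 0.
  move=> Sr SS'; rewrite {2}/c /subset_coprod (bigD1 S) /=; last first.
    by rewrite Sr eq_sym.
  move: phi0; rewrite /subset_poly (bigD1 S) //= -/(c S) => phi0.
  by rewrite mulrA [c S * _]mulrC -/(subset_coprod x t S) -/(c S) phi0 mul0r.
have diag (a b : {set 'I_n} -> U) :
    (\sum_(S : {set 'I_n} | #|S| == r) a S * c S) *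
      (\sum_(S : {set 'I_n} | #|S| == r) b S * c S) =
    \sum_(S : {set 'I_n} | #|S| == r) a S * b S * c S ^+ 2.
  rewrite mulr_suml; apply: eq_bigr => S Sr; rewrite mulr_sumr (bigD1 S) //=.
  rewrite big1 ?addr0 => [|S' /andP[S'r SS']]; first by rewrite mulrACA.
  by rewrite mulrACA c0 // mulr0.
rewrite expr2 !diag mulr_suml; apply: eq_bigr => S _.
rewrite big_set0 !mul1r [RHS]mulrC; congr (_ * _).
rewrite [RHS](bigID (mem S)) /=; congr (_ * _).
by apply: eq_bigl => i; rewrite inE.
Qed.

(** Here only the first [r] roots can be nonzero, so that every label other than
    that of [[set i | i < r]] is zero. This is the situation over the residue
    field. *)
Section Degenerate.
Variables (U : comNzRingType) (x : 'I_n -> U) (s : seq U).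
Hypothesis xE : forall i, x i = s`_i.
Hypothesis ss : size s = r.
Hypothesis rn : (r <= n)%N.
Let S0 := [set i : 'I_n | (i < r)%N].
Let y0 := \prod_(a <- s) a.

Let card_S0 : #|S0| == r.
Proof.
rewrite -sum1_card (eq_bigl (fun i : 'I_n => (i < r)%N)) => [|i]; last by rewrite inE.
by rewrite -(big_ord_widen _ (fun=> 1%N)) // sum1_card card_ord.
Qed.

Let prod_S0 (F : U -> U) : \prod_(i in S0) F (x i) = \prod_(a <- s) F a.
Proof.
rewrite (big_nth 0) big_mkord ss (big_ord_widen _ (fun i => F s`_i) rn).
by apply: eq_big => [i|i _]; rewrite ?inE ?xE.
Qed.

Let prod_neq0 S : #|S| == r -> S != S0 -> \prod_(i in S) x i = 0.
Proof.
move=> Sr SS0; have /subsetPn[i iS iS0] : ~~ (S \subset S0).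
  by apply: contra SS0 => sub; rewrite eqEcard sub (eqP card_S0) (eqP Sr) /=.
by rewrite (bigD1 i) //= xE nth_default ?mul0r // ss leqNgt; rewrite inE in iS0.
Qed.

Let coprod_S0 t : subset_coprod x t S0 = t ^+ #|[pred S : {set 'I_n} | (#|S| == r) && (S != S0)]|.
Proof.
rewrite -prodr_const; apply: eq_bigr => S /andP[Sr SS0].
by rewrite prod_neq0 // subr0.
Qed.

Lemma subset_poly_degenerate t :
  exists N, subset_poly x t = t ^+ N * (t - y0).
Proof.
exists #|[pred S : {set 'I_n} | (#|S| == r) && (S != S0)]|.
by rewrite -coprod_S0 /subset_poly (bigD1 S0) //= mulrC (prod_S0 id).
Qed.

Lemma subset_sum_degenerate : exists N, forall (f : {set 'I_n} -> {set 'I_n}) z,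
  subset_sum f x y0 z = y0 ^+ N * \prod_(i in f S0) (z - x i).
Proof.
exists #|[pred S : {set 'I_n} | (#|S| == r) && (S != S0)]| => f z.
rewrite -coprod_S0 /subset_sum (bigD1 S0) //= mulrC [X in _ + X]big1 ?addr0 //.
move=> S /andP[Sr SS0].
rewrite /subset_coprod (bigD1 S0) /=; last by rewrite card_S0 eq_sym.
by rewrite (prod_S0 id) subrr mul0r mulr0.
Qed.

End Degenerate.
End SubsetProducts.

Section PolynomialDescent.
Variables (R : comNzRingType) (n r : nat) (P : {poly R}).

Let lift (U : comNzRingType) (iota : {rmorphism R -> U}) (x : 'I_n -> U) :
  map_poly iota P = \prod_i ('X - (x i)%:P) ->
  map_poly (map_poly iota) (map_poly polyC P) = \prod_i ('X - ((x i)%:P)%:P).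
Proof.
move=> Px; rewrite -map_poly_comp (eq_map_poly (g := polyC \o iota)).
  by rewrite map_poly_comp Px map_prod_XsubC.
by move=> a /=; rewrite map_polyC.
Qed.

Lemma subset_poly_descent :
  exists F : {poly R}, forall (U : comNzRingType) (iota : {rmorphism R -> U}) x,
    map_poly iota P = \prod_i ('X - (x i)%:P) ->
    map_poly iota F = subset_poly r (fun i : 'I_n => (x i)%:P) 'X.
Proof.
have [F FE] := symmetric_descent (map_poly polyC P) (subset_poly_symmetric n r 'X).
exists F => U iota x /lift/(FE _ (map_poly iota)) ->.
rewrite (@subset_poly_morph _ _ _ _ _ _ (fun i => (x i)%:P)) /=.
  by rewrite mmapC /= map_polyX.
by move=> i; rewrite mmapX mmap1U.
Qed.

Lemma subset_sum_descent (f : {set 'I_n} -> {set 'I_n}) b :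
  (forall (s : 'S_n) (S : {set 'I_n}), f (s @: S) = s @: f S) ->
  exists F : {poly R}, forall (U : comNzRingType) (iota : {rmorphism R -> U}) x,
    map_poly iota P = \prod_i ('X - (x i)%:P) ->
    map_poly iota F = subset_sum r f (fun i => (x i)%:P) (iota b)%:P 'X.
Proof.
move=> fs; have [F FE] := symmetric_descent (map_poly polyC P)
  (subset_sum_symmetric r b%:P 'X fs).
exists F => U iota x /lift/(FE _ (map_poly iota)) ->.
rewrite (@subset_sum_morph _ _ _ _ _ _ (fun i => (x i)%:P)) /=.
  by rewrite !mmapC /= map_polyX map_polyC.
by move=> i; rewrite mmapX mmap1U.
Qed.

End PolynomialDescent.

Section HenselianRing.
Variables (R : comUnitRingType) (k : fieldType) (pi : {rmorphism R -> k}).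
Hypothesis pi_onto : forall y, exists x, pi x = y.
Hypothesis pi_unit : forall x, (x \is a GRing.unit) = (pi x != 0).
Hypothesis pi_hensel : forall (f : {poly R}) a, f \is monic -> pi f.[a] = 0 ->
  pi f^`().[a] != 0 -> exists2 b, f.[b] = 0 & pi b = pi a.

(** Coprime factorizations lift as soon as simple roots do. The products of
    r = deg q roots of P are the roots of a polynomial F over [R]. Modulo the
    maximal ideal all but r roots of P vanish, so F reduces to T^N (T - y0) with
    y0 the product of the roots of q; the simple root y0 lifts to a root b of F.
    At t = b, the subset sums H, G and D attached to a set, its complement and
    the empty set satisfy H G = D^2 P, while D reduces to a power of y0 and is
    therefore a unit: h = H / D and g = G / D are the factors. *)
Lemma hensel_factor (P : {poly R}) (m : nat) (q : {poly k}) :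
  P \is monic -> map_poly pi P = 'X^m * q -> q.[0] != 0 ->
  exists g h, [/\ g * h = P, map_poly pi g = 'X^m & map_poly pi h = q].
Proof.
move=> PM Pq q0.
have qM : q \is monic.
  by have := monic_map pi PM; rewrite Pq monicMl // monicXn.
have [n sP] : exists n, size P = n.+1.
  by exists (size P).-1; rewrite prednK // size_poly_gt0 monic_neq0.
have [r sq] : exists r, size q = r.+1.
  by exists (size q).-1; rewrite prednK // size_poly_gt0 monic_neq0.
have nE : n = (r + m)%N.
  have : size (map_poly pi P) = n.+1 by rewrite size_map_poly_id0 // (monicP PM) rmorph1 oner_eq0.
  by rewrite Pq mulrC size_Mmonic ?monic_neq0 ?monicXn // sq size_polyXn addSn addnS => -[<-].
have rn : (r <= n)%N by rewrite nE leq_addr.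
have [U [iota [xs [iI sxs xsE]]]] := splitting_ring PM sP.
have [V [jj [ys [jI sys ysE]]]] := splitting_ring qM sq.
pose x (i : 'I_n) := xs`_i; pose y (i : 'I_n) := ys`_i.
have xE : map_poly iota P = \prod_i ('X - (x i)%:P).
  by rewrite xsE (big_nth 0) sxs big_mkord.
have yE : map_poly (jj \o pi) P = \prod_i ('X - (y i)%:P).
  rewrite map_poly_comp Pq rmorphM /= map_polyXn ysE.
  rewrite -(big_mkord xpredT (fun i => 'X - (ys`_i)%:P)).
  rewrite (big_cat_nat (leq0n r) rn) /= mulrC (big_nth 0) sys; congr (_ * _).
  rewrite (eq_big_nat _ _ (F2 := fun=> 'X)) => [|i /andP[ri _]].
    by rewrite prodr_const_nat nE addKn.
  by rewrite nth_default ?subr0 // sys.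
pose y0 := (-1) ^+ r * q`_0.
have y0E : jj y0 = \prod_(a <- ys) a.
  rewrite rmorphM rmorphXn rmorphN1 -coef_map ysE coef0_prod_XsubC sys.
  by rewrite mulrA -exprD addnn -signr_odd odd_double mul1r.
have y0N0 : y0 != 0 by rewrite mulf_neq0 ?signr_eq0 // -horner_coef0.
pose Y i := (y i)%:P.
have yP i : Y i = (map polyC ys)`_i.
  have [iy|yi] := ltnP i (size ys); first by rewrite (nth_map 0).
  by rewrite /Y /y !nth_default ?size_map.
have prodY : \prod_(a <- map polyC ys) a = (jj y0)%:P.
  by rewrite big_map -rmorph_prod y0E.
have setC_perm (s : 'S_n) (S : {set 'I_n}) : ~: (s @: S) = s @: ~: S.
  apply/setP => i; rewrite -[i](permKV s) !inE !mem_imset ?inE //; exact: perm_inj.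
have id_perm (s : 'S_n) (S : {set 'I_n}) : id (s @: S) = s @: id S by [].
have set0_perm (s : 'S_n) (S : {set 'I_n}) : set0 = s @: set0 by rewrite imset0.
have [F FE] := subset_poly_descent n r P.
have FU := FE _ iota x xE; have FV := FE _ (jj \o pi) y yE.
have FM : F \is monic.
  have := monic_prod_XsubC (index_enum {set 'I_n}) (fun S : {set 'I_n} => #|S| == r) (fun S => \prod_(i in S) x i).
  suff -> : \prod_(S : {set 'I_n} | #|S| == r) ('X - (\prod_(i in S) x i)%:P) = map_poly iota F.
    rewrite !monicE (lead_coef_map_inj iI (rmorph0 _)) => /eqP lF.
    by apply/eqP/iI; rewrite rmorph1.
  by rewrite FU; apply: eq_bigr => S _; rewrite rmorph_prod.
have [N1 FVd] := subset_poly_degenerate yP (etrans (size_map _ _) sys) rn 'X.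
rewrite prodY in FVd.
have piF : map_poly pi F = 'X^N1 * ('X - y0%:P).
  apply: (map_inj_poly jI (rmorph0 _)); rewrite -map_poly_comp FV FVd.
  rewrite [RHS](rmorphM (map_poly jj)) /= map_polyXsubC.
  by rewrite map_polyXn.
have [b0 b0E] := pi_onto y0.
have piFb0 : pi F.[b0] = 0 by rewrite -horner_map piF /= b0E !hornerE subrr mulr0.
have piF'b0 : pi F^`().[b0] != 0.
  rewrite -horner_map -deriv_map piF /= b0E derivM derivXsubC !hornerE subrr mulr0 add0r.
  by rewrite expf_neq0.
have [b Fb] := pi_hensel FM piFb0 piF'b0; rewrite b0E => bE.
have [H HE] := subset_sum_descent r P b (f := id) id_perm.
have [G GE] := subset_sum_descent r P b (f := @setC _) setC_perm.
have [D DE] := subset_sum_descent r P b (f := fun=> set0) set0_perm.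
have HU := HE _ iota x xE; have HV := HE _ (jj \o pi) y yE.
have GU := GE _ iota x xE; have GV := GE _ (jj \o pi) y yE.
have DU := DE _ iota x xE; have DV := DE _ (jj \o pi) y yE.
have [N sumV] := subset_sum_degenerate yP (etrans (size_map _ _) sys) rn.
rewrite /= bE -prodY in HV GV DV; rewrite !sumV prodY in HV GV DV.
(* the products over the empty set are 1, so D does not depend on X *)
have DC : D = (D`_0)%:P.
  apply: size1_polyC; rewrite -(size_map_inj_poly iI (rmorph0 _)) DU.
  have -> z : subset_sum r (fun=> set0) (fun i => (x i)%:P) (iota b)%:P z =
      (subset_sum r (fun=> set0) x (iota b) 0)%:P.
    rewrite (@subset_sum_morph _ _ _ _ _ _ (fun i => (x i)%:P)) //.
    by apply: eq_bigr => S _; rewrite !big_set0.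
  exact: size_polyC_leq1.
have dV : jj (pi D`_0) = jj (y0 ^+ N).
  have := congr1 (fun p : {poly V} => p`_0) DV.
  by rewrite big_set0 mulr1 coef_map /= -rmorphXn /= coefC => ->; rewrite rmorphXn.
have dE : pi D`_0 = y0 ^+ N by apply: jI.
have dU : D`_0 \is a GRing.unit by rewrite pi_unit dE expf_neq0.
have HG : H * G = (D`_0 ^+ 2) *: P.
  rewrite -mul_polyC polyC_exp -DC; apply: (map_inj_poly iI (rmorph0 _)).
  rewrite expr2 !rmorphM /= HU GU DU -expr2 subset_sumM.
    by congr (_ * _); rewrite xE.
  rewrite -(@subset_poly_morph n r _ _ (@polyC U) x _ (fun=> erefl)).
  suff -> : subset_poly r x (iota b) = (map_poly iota F).[iota b].
    by rewrite horner_map Fb rmorph0.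
  rewrite FU -[RHS]/(horner_eval _ _) (@subset_poly_morph n r _ _ _ _ x).
    by rewrite /= horner_evalE hornerX.
  by move=> i; rewrite /= horner_evalE hornerC.
pose S0 := [set i : 'I_n | (i < r)%N].
have cardS0 : #|S0| = r.
  rewrite -sum1_card (eq_bigl (fun i : 'I_n => (i < r)%N)) => [|i]; last by rewrite inE.
  by rewrite -(big_ord_widen _ (fun=> 1%N)) // sum1_card card_ord.
have piG : map_poly pi G = (y0 ^+ N) *: 'X^m.
  apply: (map_inj_poly jI (rmorph0 _)); rewrite -map_poly_comp GV map_polyZ map_polyXn.
  rewrite -mul_polyC rmorphXn polyC_exp; congr (_ * _).
  rewrite (eq_bigr (fun=> 'X)) => [|i]; last first.
    by rewrite !inE -leqNgt => ri; rewrite /Y /y nth_default ?subr0 // sys.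
  by rewrite prodr_const cardsCs setCK cardS0 card_ord nE addKn.
have piH : map_poly pi H = (y0 ^+ N) *: q.
  apply: (map_inj_poly jI (rmorph0 _)); rewrite -map_poly_comp HV map_polyZ ysE.
  rewrite -mul_polyC rmorphXn polyC_exp; congr (_ * _).
  rewrite (big_nth 0) big_mkord sys (big_ord_widen n (fun i => 'X - (ys`_i)%:P)) //.
  by apply: eq_bigl => i; rewrite inE.
have scal (p : {poly k}) : (y0 ^+ N)^-1 *: (y0 ^+ N *: p) = p.
  by rewrite scalerA mulVf ?scale1r // expf_neq0.
exists ((D`_0)^-1 *: G), ((D`_0)^-1 *: H); split.
- rewrite -scalerAl -scalerAr [G * H]mulrC HG !scalerA.
  by rewrite -expr2 -exprMn mulVr // expr1n scale1r.
- by rewrite map_polyZ /= rmorphV // dE piG scal.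
- by rewrite map_polyZ /= rmorphV // dE piH scal.
Qed.
End HenselianRing.

(** * Idempotents in algebras over a henselian local ring *)

Lemma horner_algE (R : comNzRingType) (E : algType R) (a : E) (q : {poly R}) :
  horner_alg a q = \sum_(i < size q) q`_i *: a ^+ i.
Proof.
rewrite -{1}[q]coefK poly_def raddf_sum; apply: eq_bigr => i _ /=.
by rewrite linearZ /= rmorphXn /= horner_algX mulr_algl.
Qed.

Lemma horner_alg_comp (R : comNzRingType) (E : algType R) (a : E) (p q : {poly R}) :
  horner_alg a (p \Po q) = horner_alg (horner_alg a q) p.
Proof.
elim/poly_ind: p => [|p c IHp]; first by rewrite comp_poly0 !rmorph0.
rewrite comp_polyD comp_polyM comp_polyX comp_polyC !rmorphD !rmorphM /= IHp.
by rewrite !horner_algC horner_algX.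
Qed.

(** The determinant trick: [f] acts on the family [xi] through [B], so that the
    Cayley-Hamilton theorem for [B] gives a relation for [f]. *)
Lemma char_poly_annihilates (R : comNzRingType) (M : lmodType R) (f : M -> M)
    n (xi : 'I_n -> M) (B : 'M[R]_n) :
  (forall c : 'I_n -> R, f (\sum_j c j *: xi j) = \sum_j c j *: f (xi j)) ->
  (forall i, f (xi i) = \sum_j B i j *: xi j) ->
  forall i, \sum_(k < size (char_poly B)) (char_poly B)`_k *: iter k f (xi i) = 0.
Proof.
case: n xi B => [|n] xi B fsum fB i; first by case: i.
have fX k : iter k f (xi i) = \sum_j (B ^+ k) i j *: xi j.
  elim: k => [|k IHk] /=.
    rewrite (bigD1 i) //= mxE eqxx scale1r big1 ?addr0 // => j ji.
    by rewrite mxE eq_sym (negPf ji) scale0r.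
  rewrite IHk fsum exprSr.
  under [LHS]eq_bigr do rewrite fB scaler_sumr.
  rewrite exchange_big; apply: eq_bigr => j _ /=; rewrite mxE scaler_suml.
  by apply: eq_bigr => l _; rewrite scalerA.
under [LHS]eq_bigr do rewrite fX scaler_sumr.
rewrite exchange_big big1 // => j _ /=.
have := Cayley_Hamilton B => /matrixP/(_ i j).
rewrite -{1}[char_poly B]coefK poly_def raddf_sum summxE mxE => E.
transitivity ((\sum_(k < size (char_poly B)) horner_mx B ((char_poly B)`_k *: 'X^k) i j : R) *: xi j); last by rewrite E scale0r.
rewrite scaler_suml; apply: eq_bigr => k _.
by rewrite /= horner_mxZ rmorphXn /= horner_mx_X mxE scalerA.
Qed.

Lemma lift_poly (R : nzRingType) (k : nzRingType) (pi : {rmorphism R -> k}) :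
  (forall y, exists x, pi x = y) ->
  forall q : {poly k}, exists p, map_poly pi p = q.
Proof.
move=> onto; elim/poly_ind => [|q c [p <-]]; first by exists 0; rewrite rmorph0.
have [x <-] := onto c; exists (p * 'X + x%:P).
by rewrite rmorphD rmorphM /= map_polyX map_polyC.
Qed.

Section HenselianRing.
Variables (R : comUnitRingType) (k : fieldType) (pi : {rmorphism R -> k}).
Hypothesis pi_onto : forall y, exists x, pi x = y.
Hypothesis pi_unit : forall x, (x \is a GRing.unit) = (pi x != 0).
Hypothesis hensel_factor : forall (P : {poly R}) (m : nat) (q : {poly k}),
  P \is monic -> map_poly pi P = 'X^m * q -> q.[0] != 0 ->
  exists g h, [/\ g * h = P, map_poly pi g = 'X^m & map_poly pi h = q].

Lemma unitmx_residue n (N : 'M[R]_n) : map_mx pi N \in unitmx -> N \in unitmx.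
Proof. by rewrite !unitmxE det_map_mx unitfE pi_unit. Qed.

Lemma unitmx_1B n (N : 'M[R]_n) : map_mx pi N = 0 -> 1%:M - N \in unitmx.
Proof.
by move=> N0; apply: unitmx_residue; rewrite map_mxB map_mx1 N0 subr0 unitmx1.
Qed.

(** Nakayama's lemma for a finite family: 1 - N reduces to the identity, so its
    determinant is a unit. *)
Lemma nakayama_solve (M : lmodType R) n (N : 'M[R]_n) (x y : 'I_n -> M) :
  map_mx pi N = 0 -> (forall i, x i = y i + \sum_j N i j *: x j) ->
  exists W : 'M[R]_n, forall i, x i = \sum_j W i j *: y j.
Proof.
move=> N0 xy; exists (invmx (1%:M - N)) => i.
have yE j : y j = \sum_l (1%:M - N) j l *: x l.
  rewrite {1}[LHS](_ : _ = x j - \sum_l N j l *: x l); last by rewrite {1}xy addrK.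
  rewrite [X in X - _](_ : _ = \sum_l (1%:M : 'M[R]_n) j l *: x l); last first.
    rewrite (bigD1 j) //= mxE eqxx scale1r big1 ?addr0 // => l lj.
    by rewrite mxE eq_sym (negPf lj) scale0r.
  by rewrite -sumrB; apply: eq_bigr => l _; rewrite !mxE scalerBl.
under [RHS]eq_bigr do rewrite yE scaler_sumr.
rewrite exchange_big (bigD1 i) //= [X in _ + X]big1 ?addr0 => [|l li].
  under eq_bigr do rewrite scalerA.
  rewrite -scaler_suml; have := mulVmx (unitmx_1B N0) => /matrixP/(_ i i).
  by rewrite !mxE eqxx => ->; rewrite scale1r.
under eq_bigr do rewrite scalerA.
rewrite -scaler_suml; have := mulVmx (unitmx_1B N0) => /matrixP/(_ i l).
by rewrite !mxE eq_sym (negPf li) => ->; rewrite scale0r.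
Qed.

Import Pdiv.CommonRing Pdiv.RingMonic.
Section Element.
Variables (E : algType R).

(** Write P = g h with g reducing to a power of X and h(0) a unit. Since g and h
    are coprime modulo the maximal ideal, u h + w g = 1 + nu for some u, w and a
    small nu; by Nakayama's lemma 1 + nu has an inverse [om] in the algebra
    generated by [b]. Thus eps = om w g is an idempotent. Where eps is the
    identity h(b) vanishes, and h(0) being a unit makes [b] invertible; where
    eps vanishes so does g(b), and g(1) being a unit makes 1 - b invertible. *)
Lemma monic_splitting (b : E) (P : {poly R}) :
  P \is monic -> horner_alg b P = 0 ->
  exists eps al be : {poly R},
  [/\ horner_alg b (eps * eps) = horner_alg b eps,
      horner_alg b (al * 'X) = horner_alg b eps
    & horner_alg b (be * (1 - 'X)) = horner_alg b (1 - eps)].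
Proof.
move=> PM Pb; pose ev : {rmorphism {poly R} -> E} := horner_alg b; have {}Pb : ev P = 0 by [].
have PM' : map_poly pi P \is monic by apply: monic_map.
have [m [q q0 Pq]] := multiplicity_XsubC (map_poly pi P) 0.
rewrite monic_neq0 //= in q0; rewrite subr0 mulrC in Pq.
have [g [h [gh pig pih]]] := hensel_factor PM Pq q0.
have [[u1 u2] /= Bz] : exists u, u.1 * 'X^m + u.2 * q = 1.
  apply/Bezout_eq1_coprimepP; rewrite coprimep_expl //.
  by have := coprimep_XsubC q 0; rewrite subr0 coprimep_sym => ->.
have [w piw] := lift_poly pi_onto u1; have [u piu] := lift_poly pi_onto u2.
pose nu := u * h + w * g - 1.
have pinu : map_poly pi nu = 0.
  by rewrite rmorphB rmorphD !rmorphM /= pig pih piw piu rmorph1 -Bz; ring.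
have [n sP] : exists n, size P = n.+2.
  case sP : (size P) => [|[|n]]; last by exists n.
    by move/eqP: sP; rewrite size_poly_eq0 (negPf (monic_neq0 PM)).
  have P1 : P = 1.
    by move/monicP: (PM); rewrite (size1_polyC (eq_leq sP)) lead_coefC => ->.
  by move/eqP: Pb; rewrite P1 rmorph1 oner_eq0.
(* nu(b) b^i, reduced modulo P, is a small combination of 1, b, ..., b^n *)
pose rho (i : 'I_n.+1) := rmodp (nu * 'X^i) P.
have srho i : (size (rho i) <= n.+1)%N.
  by rewrite -ltnS -sP ltn_rmodp monic_neq0.
have evrho i : ev (rho i) = ev nu * b ^+ i.
  have := congr1 ev (rdivp_eq PM (nu * 'X^i)).
  by rewrite rmorphD !rmorphM /= Pb mulr0 add0r rmorphXn /= horner_algX.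
have pirho i : map_poly pi (rho i) = 0.
  have := congr1 (map_poly pi) (rdivp_eq PM (nu * 'X^i)).
  rewrite rmorphD !rmorphM /= pinu mul0r -/(rho i) => /esym E0.
  rewrite -[LHS](rmodp_addl_mul_small PM' (map_poly pi (rdivp (nu * 'X^i) P))).
    by rewrite E0 rmod0p.
  rewrite (leq_ltn_trans (size_poly _ _)) // size_map_poly_id0; last first.
    by rewrite (monicP PM) rmorph1 oner_eq0.
  by rewrite sP ltnS srho.
have [||W WE] := @nakayama_solve E n.+1 (\matrix_(i, j) - (rho i)`_j)
    (fun i => b ^+ i) (fun i => (1 + ev nu) * b ^+ i).
- by apply/matrixP => i j; rewrite !mxE rmorphN -coef_map pirho coef0 oppr0.
- move=> i; rewrite mulrDl mul1r -addrA -[LHS]addr0; congr (_ + _).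
  rewrite -evrho [ev _]horner_algE (big_ord_widen n.+1 (fun j => (rho i)`_j *: b ^+ j)) //.
  rewrite big_mkcond -big_split big1 //= => j _; rewrite !mxE scaleNr.
  by case: ifP => [|/negbT]; rewrite ?subrr // -leqNgt => ?; rewrite nth_default // scale0r subr0.
pose om := \sum_j W ord0 j *: 'X^j.
have evZ c q1 : ev (c *: q1) = c *: ev q1 by rewrite [LHS]linearZ /= mulr_algl.
have evom : ev (om * (1 + nu)) = 1.
  have -> : ev (om * (1 + nu)) = ev om * (1 + ev nu) by rewrite rmorphM rmorphD rmorph1.
  apply: etrans (esym (WE ord0)).
  rewrite /om raddf_sum mulr_suml; apply: eq_bigr => j _.
  rewrite [X in X * _]evZ -scalerAl; congr (_ *: _); rewrite -(rmorph1 ev) -rmorphD.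
  have <- : ev ('X^j) = b ^+ j by rewrite rmorphXn; congr (_ ^+ _); apply: horner_algX.
  by rewrite -!rmorphM mulrC.
pose zeta := om * (1 + nu) - 1.
have zeta0 : ev zeta = 0 by rewrite rmorphB evom rmorph1 subrr.
have ker p q' : ev p = 0 -> ev (q' * p) = 0 by move=> p0; rewrite rmorphM p0 mulr0.
have gh0 : ev (g * h) = 0 by rewrite gh.
pose eps := om * w * g.
have eqev p1 p2 c1 c2 : p1 - p2 = c1 * (g * h) + c2 * zeta -> ev p1 = ev p2.
  move=> p12; apply/eqP; rewrite -subr_eq0 -rmorphB p12 rmorphD.
  by rewrite (ker _ _ gh0) (ker _ _ zeta0) addr0.
have [h1 [h0 hE]] : exists h1 h0, h = h1 * 'X + h0%:P.
  by elim/poly_ind: (h) => [|h1 h0 _]; [exists 0, 0; rewrite mul0r addr0|exists h1, h0].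
have h0U : h0 \is a GRing.unit.
  by rewrite pi_unit; move: q0; rewrite rootE -pih hE -(rmorph0 pi) horner_map !hornerE.
have [g1 gE] : exists g1, g = g1 * ('X - 1) + g.[1]%:P.
  have /factor_theorem[g1 gE] : root (g - g.[1]%:P) 1 by rewrite rootE !hornerE subrr.
  by exists g1; rewrite -polyC1 -gE subrK.
have g1U : g.[1] \is a GRing.unit.
  by rewrite pi_unit -horner_map rmorph1 pig hornerXn expr1n oner_eq0.
have h0V : h0^-1%:P * h0%:P = 1 :> {poly R} by rewrite -polyCM mulVr.
have g1V : g.[1]^-1%:P * g.[1]%:P = 1 :> {poly R} by rewrite -polyCM mulVr.
exists eps, (- h0^-1%:P * h1 * eps), (g.[1]^-1%:P * g1 * (1 - eps)).
split; rewrite -/ev.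
- apply: (eqev _ _ (- om ^+ 2 * u * w) (om * w * g)); rewrite /eps /zeta /nu; ring.
- apply: (eqev _ _ (- h0^-1%:P * om * w) 0).
  rewrite /eps mul0r addr0 [in g * h]hE.
  transitivity (- h0^-1%:P * om * w * g * (h1 * 'X) - h0^-1%:P * h0%:P * (om * w * g)).
    by rewrite h0V; ring.
  by ring.
apply: (eqev _ _ (- g.[1]^-1%:P * om * u) (g.[1]^-1%:P * g)).
rewrite /eps /zeta; transitivity (g.[1]^-1%:P * g1 * (1 - om * w * g) * (1 - 'X) -
    g.[1]^-1%:P * g.[1]%:P * (1 - om * w * g)).
  by rewrite g1V mul1r.
transitivity (- (g.[1]^-1%:P) * (g1 * ('X - 1) + g.[1]%:P) * (1 - om * w * g)); first by ring.
rewrite -gE /nu; ring.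
Qed.

Lemma residue_monic_lift (p : {poly R}) : map_poly pi p \is monic ->
  exists2 p1 : {poly R}, p1 \is monic &
    map_poly pi p1 = map_poly pi p /\ size p1 = size (map_poly pi p).
Proof.
move=> pM; have [d sp] : exists d, size (map_poly pi p) = d.+1.
  by exists (size (map_poly pi p)).-1; rewrite prednK // size_poly_gt0 monic_neq0.
have sT : (size (take_poly d p) < size ('X^d : {poly R}))%N.
  by rewrite size_polyXn ltnS size_take_poly.
exists ('X^d + take_poly d p); first by rewrite monicE lead_coefDl // lead_coefXn.
split; last by rewrite size_polyDl // size_polyXn sp.
apply/polyP => i; rewrite !coef_map coefD coefXn coef_take_poly /= rmorphD.
case: ltngtP => [id|di|->].
- by rewrite rmorph0 add0r.
- by rewrite rmorph0 addr0 -coef_map nth_default // sp.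
- rewrite rmorph1 rmorph0 addr0 -coef_map.
  by move/monicP: pM; rewrite lead_coefE sp.
Qed.

(** A primitive relation p(a) = 0 need not make [a] integral, as some of its
    roots may lie at infinity; the change of variable b = a / theta(a) brings
    them back to 0. For this theta = 1 + X (X - 1) p1, with p1 a monic lift of
    the reduction of p, has degree at least 2 and is coprime to p modulo the
    maximal ideal, so that V(a) = 1 / theta(a) exists. As theta(0) = theta(1) = 1,
    moreover, b is a multiple of [a] and 1 - b one of 1 - a. *)
Lemma primitive_to_integral (a : E) (p : {poly R}) :
  map_poly pi p != 0 -> horner_alg a p = 0 ->
  exists V p1 P : {poly R},
  [/\ horner_alg a (V * (1 + 'X * ('X - 1) * p1)) = 1,
      P \is monic & horner_alg (horner_alg a ('X * V)) P = 0].
Proof.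
pose ev : {rmorphism {poly R} -> E} := horner_alg a.
move=> pN0; wlog pM : p pN0 / map_poly pi p \is monic => [wlogM|].
  have [c pic] := pi_onto (lead_coef (map_poly pi p)).
  have cU : c \is a GRing.unit by rewrite pi_unit pic lead_coef_eq0.
  have piV : pi c^-1 = (lead_coef (map_poly pi p))^-1 by rewrite rmorphV // pic.
  move=> pa; apply: (wlogM (c^-1 *: p)).
  - by rewrite map_polyZ piV scaler_eq0 invr_eq0 lead_coef_eq0 (negPf pN0).
  - by rewrite map_polyZ piV monicE lead_coefZ mulVf // lead_coef_eq0.
  - by rewrite linearZ /= pa mulr0.
move=> pa; have {}pa : ev p = 0 by [].
have [p1 p1M [pip1 sp1]] := residue_monic_lift pM.
pose d := (size p1).-1; have sp1' : size p1 = d.+1.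
  by rewrite prednK // size_poly_gt0 monic_neq0.
pose n := size p; have dn : (d < n)%N by rewrite -sp1' sp1 size_poly.
pose p2 := p - p1; have pip2 : map_poly pi p2 = 0 by rewrite rmorphB /= pip1 subrr.
have sp2 : (size p2 <= n)%N.
  by rewrite (leq_trans (size_polyD _ _)) // size_polyN geq_max leqnn sp1'.
pose th := 1 + 'X * ('X - 1) * p1.
have XX1M : 'X * ('X - 1) \is (@monic R) by rewrite monicMl ?monicX // -polyC1 monicXsubC.
have sXX1 : size ('X * ('X - 1) : {poly R}) = 3%N.
  by rewrite mulrC size_mulX ?polyXsubC_eq0 // -polyC1 ?size_XsubC ?polyXsubC_eq0.
have sq1 : size ('X * ('X - 1) * p1) = d.+3.
  by rewrite size_Mmonic ?monic_neq0 // sXX1 sp1'.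
have thE : th = 'X * ('X - 1) * p1 + 1 by rewrite addrC.
have sth : size th = d.+3 by rewrite thE size_polyDl sq1 // size_poly1.
have thM : th \is monic.
  rewrite monicE thE lead_coefDl ?sq1 ?size_poly1 //.
  by rewrite -monicE monicMl.
have small_mul (v : {poly R}) (c : nat) : (size (v * th)%R <= c + d.+2)%N -> (size v <= c)%N.
  have [->|v0] := eqVneq v 0; first by rewrite size_poly0.
  by rewrite size_Mmonic // sth addnS /= leq_add2r.
(* division by theta, then by p1, reduces each power of X *)
pose N := (n + d.+2)%N.
have step (i : 'I_N) : exists v u r : {poly R}, [/\ 'X^i = v * th + u * p + r,
    (size v <= n)%N, (size r <= N)%N & map_poly pi r = 0].
  pose q := rdivp 'X^i th; pose ro := rmodp 'X^i th.
  pose q' := rdivp (- ro * ('X * ('X - 1))) th; pose ro' := rmodp (- ro * ('X * ('X - 1))) th.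
  have E1 : 'X^i = q * th + ro by apply: rdivp_eq.
  have E2 : - ro * ('X * ('X - 1)) = q' * th + ro' by apply: rdivp_eq.
  have sro : (size ro <= d.+2)%N by rewrite -ltnS -sth ltn_rmodpN0 // monic_neq0.
  have sro' : (size ro' <= d.+2)%N by rewrite -ltnS -sth ltn_rmodpN0 // monic_neq0.
  have E3 : ro = (ro + q' * p1) * th + ro' * p1.
    have -> : (ro + q' * p1) * th = ro * th + q' * th * p1 by ring.
    by rewrite -addrA -mulrDl -E2 /th; ring.
  exists (q + (ro + q' * p1)), ro', (- (ro' * p2)); split.
  - by rewrite {1}E1 {1}E3 /p2; ring.
  - rewrite (leq_trans (size_polyD _ _)) // geq_max; apply/andP; split.
      apply: small_mul; have -> : q * th = 'X^i - ro by rewrite E1 addrK.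
      rewrite (leq_trans (size_polyD _ _)) // geq_max size_polyN size_polyXn ltn_ord.
      by rewrite (leq_trans sro) // leq_addl.
    apply: leq_trans dn; apply: ltnW; apply: small_mul.
    have -> : (ro + q' * p1) * th = ro - ro' * p1 by rewrite {2}E3 addrK.
    rewrite (leq_trans (size_polyD _ _)) // geq_max size_polyN (leq_trans sro) ?leq_addl //=.
    by rewrite (leq_trans (size_polyMleq _ _)) // sp1' addnS /= addnC leq_add2l.
  - rewrite size_polyN (leq_trans (size_polyMleq _ _)) //.
    by rewrite (leq_trans (leq_pred _)) // /N addnC leq_add.
  - by rewrite rmorphN rmorphM /= pip2 mulr0 oppr0.
have evE q : ev q = \sum_(i < size q) q`_i *: a ^+ i := horner_algE a q.
have evX i : ev 'X^i = a ^+ i by rewrite rmorphXn; congr (_ ^+ _); apply: horner_algX.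
have evZ c q : ev (c *: q) = c *: ev q by rewrite [LHS]linearZ /= mulr_algl.
have ev_small (q : {poly R}) c : (size q <= c)%N -> ev q = \sum_(i < c) q`_i *: a ^+ i.
  move=> qc; rewrite evE (big_ord_widen c (fun j => q`_j *: a ^+ j)) // big_mkcond.
  by apply: eq_bigr => j _; case: ltnP => // qj; rewrite nth_default ?scale0r.
have [v vP] := fin_all_exists step.
have [W WE] : exists W : 'M[R]_N, forall i : 'I_N, a ^+ i = \sum_j W i j *: ev (v j * th).
  have [u uP] := fin_all_exists vP; have [r rP] := fin_all_exists uP.
  apply: (@nakayama_solve _ _ (\matrix_(i, j) (r i)`_j)).
    apply/matrixP => i j; rewrite !mxE -coef_map.
    by have [_ _ _ ->] := rP i; rewrite coef0.
  move=> i; have [E1 _ sr _] := rP i.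
  rewrite -evX E1 !rmorphD [ev (u i * p)]rmorphM pa mulr0 addr0 (ev_small _ _ sr).
  by congr (_ + _); apply: eq_bigr => j _; rewrite mxE.
have sv (j : 'I_N) : (size (v j) <= n)%N by have [u [r []]] := vP j.
pose z (i : 'I_N) : {poly R} := \sum_j W i j *: v j.
have sz i : (size (z i) <= n)%N.
  apply: (leq_trans (size_sum _ _ _)); apply/bigmax_leqP => j _.
  exact: leq_trans (size_scale_leq _ _) (sv j).
have zth (i : 'I_N) : a ^+ i = ev (z i * th).
  rewrite WE /z mulr_suml raddf_sum; apply: eq_bigr => j _.
  by rewrite -scalerAl [RHS]evZ.
have N0 : (0 < N)%N by rewrite /N addnS.
pose V : {poly R} := z (Ordinal N0); have VE : ev (V * th) = 1 by rewrite -zth expr0.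
have n0 : (0 < n)%N by apply: leq_ltn_trans dn.
have nN (i : 'I_n) : (i.+1 < N)%N by rewrite /N addnS ltnS (leq_trans (ltn_ord i)) ?leq_addr.
pose B : 'M[R]_n := \matrix_(i, j) (z (Ordinal (nN i)))`_j.
exists V, p1, (char_poly B); split=> //; first exact: char_poly_monic.
have fsum (c : 'I_n -> R) : ev ('X * V) * (\sum_j c j *: a ^+ j) =
    \sum_j c j *: (ev ('X * V) * a ^+ j).
  by rewrite mulr_sumr; apply: eq_bigr => j _; rewrite scalerAr.
have fB (i : 'I_n) : ev ('X * V) * a ^+ i = \sum_j B i j *: a ^+ j.
  rewrite -evX -rmorphM; transitivity (ev (z (Ordinal (nN i)) * (V * th))).
    have -> : 'X * V * 'X^i = V * 'X^(i.+1) :> {poly R} by rewrite exprS; ring.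
    rewrite rmorphM evX (zth (Ordinal (nN i))) -rmorphM; congr (ev _); ring.
  rewrite rmorphM VE mulr1 (ev_small _ _ (sz _)).
  by apply: eq_bigr => j _; rewrite mxE.
(* the relation applied to a^0 = 1 *)
have := char_poly_annihilates fsum fB (Ordinal n0).
rewrite horner_algE => {2}<-; apply: eq_bigr => j _; congr (_ *: _).
elim: (j : nat) => //= l IHl; by rewrite -IHl exprS.
Qed.

(** The splitting for b = a V(a) is one for [a], since [a] divides b and 1 - a
    divides 1 - b in the algebra generated by [a]. *)
Lemma primitive_splitting (a : E) (p : {poly R}) :
  map_poly pi p != 0 -> horner_alg a p = 0 ->
  exists eps al be : {poly R},
  [/\ horner_alg a (eps * eps) = horner_alg a eps,
      horner_alg a (al * 'X) = horner_alg a eps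
    & horner_alg a (be * (1 - 'X)) = horner_alg a (1 - eps)].
Proof.
move=> pN0 pa; have [V [p1 [P [VE PM Pb]]]] := primitive_to_integral pN0 pa.
have [e [al [be []]]] := monic_splitting PM Pb.
pose ev : {rmorphism {poly R} -> E} := horner_alg a; have {}VE : ev _ = 1 := VE.
rewrite -!horner_alg_comp -!polyC1 !(comp_polyM, comp_polyB, comp_polyX, comp_polyC) polyC1.
move=> ee ale bee.
exists (e \Po ('X * V)), ((al \Po ('X * V)) * V).
exists ((be \Po ('X * V)) * V * (1 - 'X * p1)); split=> //.
  by rewrite -ale; congr (horner_alg a _); ring.
rewrite -bee; set b' := be \Po _.
have -> : b' * V * (1 - 'X * p1) * (1 - 'X) =
    b' * (1 - 'X * V) + b' * (V * (1 + 'X * ('X - 1) * p1) - 1) by ring.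
by rewrite -/(ev _) rmorphD [ev (b' * (_ - 1))]rmorphM rmorphB VE rmorph1 subrr mulr0 addr0.
Qed.
End Element.
End HenselianRing.

(** * Rings with involution: the radical *)

Definition is_involution (S : pzRingType) (star : S -> S) : Prop :=
  [/\ forall x y, star (x + y) = star x + star y,
      forall x y, star (x * y) = star y * star x
    & forall x, star (star x) = x].

Section Involution.
Variables (S : pzRingType) (star : S -> S).
Hypothesis inv_star : is_involution star.

Lemma starD x y : star (x + y) = star x + star y. Proof. by case: inv_star. Qed.
Lemma starM x y : star (x * y) = star y * star x. Proof. by case: inv_star. Qed.
Lemma starK x : star (star x) = x. Proof. by case: inv_star. Qed.
Lemma star0 : star 0 = 0.
Proof. by apply: (addrI (star 0)); rewrite -starD !addr0. Qed.
Lemma starN x : star (- x) = - star x.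
Proof. by apply/eqP; rewrite -addr_eq0 -starD addNr star0. Qed.
Lemma starB x y : star (x - y) = star x - star y.
Proof. by rewrite starD starN. Qed.
Lemma star1 : star 1 = 1.
Proof. by rewrite -[star 1]mul1r -{1}[1]starK -starM mul1r starK. Qed.
Lemma starMn x n : star (x *+ n) = star x *+ n.
Proof. by elim: n => [|n IHn]; rewrite ?star0 // !mulrS starD IHn. Qed.

End Involution.

(** Invertibility on one side; it is two-sided under [dedekind_finite]. *)
Definition invertible (S : pzRingType) (x : S) : Prop := exists y, x * y = 1.

Definition dedekind_finite (S : pzRingType) : Prop :=
  forall x y : S, x * y = 1 -> y * x = 1.

Section SymmetricDichotomy.
Variables (S : nzRingType) (star : S -> S).
Implicit Types (a s x y z : S).
Hypothesis inv_star : is_involution star.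
Hypothesis DF : dedekind_finite S.
Variable h : S.
Hypothesis h2 : h *+ 2 = 1.
Hypothesis dichotomy :
  forall a, star a = a -> invertible a \/ invertible (1 - a).

Let hC x : h * x = x * h.
Proof.
have E y : y = h * y *+ 2 by rewrite -mulrnAl h2 mul1r.
rewrite [LHS]E [RHS]E -[LHS]mulrnAr -[RHS]mulrnAr; congr (h * _).
by rewrite -mulrnAl h2 mul1r -mulrnAr h2 mulr1.
Qed.

Let half x : x * h + x * h = x.
Proof. by rewrite -mulrDr -mulr2n h2 mulr1. Qed.

Let star_h : star h = h.
Proof.
have : star h *+ 2 = h *+ 2 by rewrite -(starMn inv_star) h2 (star1 inv_star).
by move=> /(congr1 (fun z => h * z)); rewrite !mulrnAr -!mulrnAl h2 !mul1r.
Qed.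

Lemma invertibleM x y : invertible x -> invertible y -> invertible (x * y).
Proof.
move=> [x' xx'] [y' yy']; exists (y' * x').
by rewrite mulrA -(mulrA x) yy' mulr1.
Qed.

Lemma invertible_left x y : invertible (x * y) -> invertible x.
Proof. by move=> [z xyz]; exists (y * z); rewrite mulrA. Qed.

Lemma invertible_right x y : invertible (x * y) -> invertible y.
Proof. by move=> [z xyz]; exists (z * x); rewrite mulrA; apply: DF; rewrite mulrA. Qed.

Lemma invertible_star x : invertible x -> invertible (star x).
Proof.
move=> [y /DF yx]; exists (star y).
by rewrite -(starM inv_star) yx (star1 inv_star).
Qed.

Lemma invertible_1B_swap x y : invertible (1 - x * y) -> invertible (1 - y * x).
Proof.
move=> [c xyc]; exists (1 + y * c * x).
have -> : (1 - y * x) * (1 + y * c * x) = 1 - y * x + y * ((1 - x * y) * c) * x.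
  rewrite mulrDr mulr1; congr (_ + _); rewrite !mulrBl !mul1r mulrBr mulrBl.
  by rewrite !mulrA.
by rewrite xyc mulr1 subrK.
Qed.

Let N a := star a = a /\ ~ invertible a.

Let N_opp a : N a -> N (- a).
Proof.
move=> [sa Ua]; split; first by rewrite (starN inv_star) sa.
by move=> [y ay]; apply: Ua; exists (- y); rewrite mulrN -mulNr.
Qed.

Let N_conj a z : N a -> N (z * a * star z).
Proof.
move=> [sa Ua]; split; first by rewrite !(starM inv_star) (starK inv_star) sa mulrA.
by move=> /invertible_left/invertible_right.
Qed.

Let N_1B a z : N a -> invertible (1 - a * (star z * z)).
Proof.
move=> Na; have [sa Ua] := N_conj z Na; case: (dichotomy sa) => //.
by rewrite -mulrA => /invertible_1B_swap; rewrite mulrA.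
Qed.

Let N_quot a s t' : N a -> star s = s -> (1 - a * s) * t' = 1 -> N (t' * a).
Proof.
move=> [sa Ua] ss tt'; split; last by move=> /invertible_right.
have ta : (1 - a * s) * a = a * star (1 - a * s).
  by rewrite (starB inv_star) (star1 inv_star) (starM inv_star) sa ss mulrBl mulrBr mul1r mulr1 mulrA.
rewrite (starM inv_star) sa; have t't := DF tt'.
rewrite -[LHS]mul1r -t't -[LHS]mulrA (mulrA _ a) ta -(mulrA a) -(starM inv_star) t't.
by rewrite (star1 inv_star) mulr1.
Qed.

Let N_1B_sym a s : N a -> star s = s -> invertible (1 - a * s).
Proof.
move=> Na ss.
pose z := (s + 1) * h; pose w := (s - 1) * h.
have sz : star z = z by rewrite (starM inv_star) star_h hC (starD inv_star) ss (star1 inv_star).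
have sw : star w = w by rewrite (starM inv_star) star_h hC (starB inv_star) ss (star1 inv_star).
have sE : s = z * z - w * w.
  have zw : z = w + 1 by rewrite -h2 mulr2n /z /w mulrDl mulrBl mul1r addrA subrK.
  have ww : w + w = s - 1 by rewrite half.
  by rewrite zw mulrDl mulrDr mulr1 mul1r -!addrA addrC -!addrA addNr addr0 addrA ww subrK.
clearbody z w.
have [t' tt'] : invertible (1 - a * (- (w * w))).
  have /N_1B : N (- a) by apply: N_opp.
  by move=> /(_ w); rewrite sw mulrN mulNr.
have N' : N (t' * a).
  by apply: (N_quot Na _ tt'); rewrite (starN inv_star) (starM inv_star) sw.
have [y ty] := N_1B z N'; rewrite sz in ty.
suff -> : 1 - a * s = (1 - a * (- (w * w))) * (1 - t' * a * (z * z)).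
  by apply: invertibleM; [exists t'|exists y].
by rewrite mulrBr mulr1 -!mulrA (mulrA _ t') tt' mul1r sE mulrN opprK mulrBr opprB addrA.
Qed.

(** The dichotomy makes 1 - z a z^* invertible for every z, hence 1 - a z^* z.
    A symmetric s is the difference of the squares of (s + 1) / 2 and
    (s - 1) / 2, and splitting off one square at a time makes 1 - a s
    invertible. In general y = s + k with s symmetric and k skew; then
    1 - a y = (1 - a s) (1 - a' k), where a' = (1 - a s)^-1 a is again symmetric,
    and (1 - a' k) (1 + a' k) = 1 - a' (k a' k) with k a' k symmetric. *)
Lemma symmetric_nonunit_radical a y : star a = a -> ~ invertible a ->
  invertible (1 - a * y).
Proof.
move=> sa Ua; have Na : N a by [].
pose s := (y + star y) * h; pose k := (y - star y) * h.
have ss : star s = s.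
  by rewrite (starM inv_star) star_h hC (starD inv_star) (starK inv_star) addrC.
have sk : star k = - k.
  by rewrite (starM inv_star) star_h hC (starB inv_star) (starK inv_star) -mulNr opprB.
have yE : y = s + k by rewrite -mulrDl addrACA subrr addr0 mulrDl half.
clearbody s k.
have [t' tt'] := N_1B_sym Na ss; have [sa' Ua'] := N_quot Na ss tt'.
have -> : 1 - a * y = (1 - a * s) * (1 - t' * a * k).
  by rewrite mulrBr mulr1 -!mulrA (mulrA _ t') tt' mul1r yE mulrDr opprD addrA.
apply: invertibleM; first by exists t'.
set a' := t' * a in sa' Ua' *; clearbody a'; apply: (@invertible_left _ (1 + a' * k)).
have -> : (1 - a' * k) * (1 + a' * k) = 1 - a' * (k * a' * k).
  by rewrite mulrDr mulr1 mulrBl mul1r addrA subrK !mulrA.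
apply: N_1B_sym => //; rewrite !(starM inv_star) sk sa'.
by rewrite mulrN mulNr mulrN opprK mulrA.
Qed.

Definition in_radical x := forall y, invertible (1 - x * y).

Lemma radicalMr x z : in_radical x -> in_radical (x * z).
Proof. by move=> Jx y; rewrite -mulrA. Qed.

Lemma radicalMl x z : in_radical x -> in_radical (z * x).
Proof. by move=> Jx y; rewrite -mulrA; apply: invertible_1B_swap; rewrite -mulrA. Qed.

Lemma radicalN x : in_radical x -> in_radical (- x).
Proof. by rewrite -mulrN1; apply: radicalMr. Qed.

Lemma invertible_radicalD x c : invertible c -> in_radical x -> invertible (c + x).
Proof.
move=> [d cd] Jx; have -> : c + x = c * (1 - d * x * -1).
  by rewrite mulrN1 opprK mulrDr mulr1 !mulrA cd mul1r.
by apply: invertibleM; [exists d|apply: radicalMl].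
Qed.

Lemma radicalD x y : in_radical x -> in_radical y -> in_radical (x + y).
Proof.
move=> Jx Jy z; rewrite mulrDl opprD addrA; apply: invertible_radicalD => //.
exact/radicalN/radicalMr.
Qed.

Lemma radical0 : in_radical 0.
Proof. by move=> y; exists 1; rewrite mul0r subr0 mulr1. Qed.

Let cong x y := in_radical (x - y).

Let cong_refl x : cong x x. Proof. by rewrite /cong subrr; apply: radical0. Qed.
Let cong_sym x y : cong x y -> cong y x.
Proof. by move=> xy; rewrite /cong -opprB; apply: radicalN. Qed.
Let cong_trans x y z : cong x y -> cong y z -> cong x z.
Proof. by move=> xy yz; rewrite /cong -(subrKA y); apply: radicalD. Qed.
Let congD x x' y y' : cong x x' -> cong y y' -> cong (x + y) (x' + y').
Proof. by move=> xx yy; rewrite /cong opprD addrACA; apply: radicalD. Qed.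
Let congN x x' : cong x x' -> cong (- x) (- x').
Proof. by move=> xx; rewrite /cong -opprD; apply: radicalN. Qed.
Let congM x x' y y' : cong x x' -> cong y y' -> cong (x * y) (x' * y').
Proof.
move=> xx yy; rewrite /cong -(subrKA (x' * y)) -mulrBl -mulrBr.
by apply: radicalD; [apply: radicalMr|apply: radicalMl].
Qed.
Let cong_invertible x y : cong x y -> invertible y -> invertible x.
Proof. by move=> xy Uy; rewrite -(subrK y x) addrC; apply: invertible_radicalD. Qed.
Let invertible_2X m : invertible (2%:R ^+ m : S).
Proof.
elim: m => [|m IHm]; first by exists 1; rewrite mulr1.
by rewrite exprS; apply: invertibleM => //; exists h; rewrite mulr_natl.
Qed.

Ltac cong_step E := first [exact: cong_refl | exact: E |
  apply: congD; cong_step E | apply: congN; cong_step E | apply: congM; cong_step E].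

(** Here b = e u is the component at [e] of an isometric copy [u] of [e], in the
    corner ring of [e]. If 1 - b, respectively 1 + b, is invertible, a
    quasi-reflection takes [e], respectively - e, to [u]. Otherwise the symmetric
    elements (1 - b) (1 - b)^* and (1 + b) (1 + b)^* are not invertible; so they lie
    in the radical, whence b^* = - b and b^2 = 1 modulo the radical. In that case
    let v = 2 e + u (e - b). Then vv = v^* v lies in the radical, and
    r = vv / 2 + 2 (b^* - b), congruent to - 4 b, is invertible and satisfies
    r + r^* = vv: it defines a quasi-reflection w along v. The last expression is
    e - u^* (w e), congruent to 2, so that a second one takes w e to [u]. *)
Lemma reflection_trichotomy b :
  let b' := star b in
  let vv := 1 *+ 4 + (b * (1 - b)) *+ 2 + ((1 - b') * b') *+ 2 + (1 - b') * (1 - b) in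
  let r := h * vv + (b' - b) *+ 2 in
  [\/ invertible (1 - b), invertible (1 + b) |
    exists2 r', r * r' = 1 &
      invertible (1 - (b' - (b' *+ 2 + (1 - b)) * r' * (1 *+ 2 + (1 - b') * b')))].
Proof.
move=> b' vv r.
have [?|UB] := pselect (invertible (1 - b)); first by constructor 1.
have [?|UD] := pselect (invertible (1 + b)); first by constructor 2.
constructor 3.
have J1 : in_radical ((1 - b) * star (1 - b)).
  move=> y; apply: symmetric_nonunit_radical; last by move=> /invertible_left.
  by rewrite (starM inv_star) (starK inv_star).
have J2 : in_radical ((1 + b) * star (1 + b)).
  move=> y; apply: symmetric_nonunit_radical; last by move=> /invertible_left.
  by rewrite (starM inv_star) (starK inv_star).
rewrite (starD inv_star) (star1 inv_star) mulrDl mul1r mulrDr mulr1 -/b' in J2.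
rewrite (starB inv_star) (star1 inv_star) mulrBl mul1r mulrBr mulr1 -/b' in J1.
have halfJ x : in_radical (x + x) -> in_radical x.
  by move=> /(radicalMr h); rewrite mulrDl half.
have DE : 1 + b' + (b + b * b') = (1 + b * b') + (b' + b).
  by rewrite [b + _]addrC addrACA.
have BE : 1 - b' - (b - b * b') = (1 + b * b') - (b' + b).
  by rewrite opprB addrACA -opprD.
rewrite DE in J2; rewrite BE in J1.
have b'E : cong b' (- b).
  apply: halfJ; rewrite opprK; have := radicalD J2 (radicalN J1).
  by rewrite opprB [_ + b - _]addrC addrACA subrr add0r.
have b'N : cong (- b') b by have := congN b'E; rewrite opprK.
have bb'E : cong (b * b') (- 1).
  apply: halfJ; rewrite opprK [_ + 1]addrC; have := radicalD J2 J1.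
  by rewrite addrACA subrr addr0.
have bbE : cong (b * b) 1.
  have -> : b * b = - (b * - b) by rewrite mulrN opprK.
  apply: (@cong_trans _ (- (b * b'))); last by rewrite -[1]opprK; apply: congN.
  by cong_step (cong_sym b'E).
(* identities modulo b^2 = 1 are checked in Z[X] / (X^2 - 1) *)
have comb : commr_rmorph (intr : int -> S) b by move=> n; apply: commr_int.
pose ev : {rmorphism {poly int} -> S} := horner_morph comb.
have evX : ev 'X = b by apply: horner_morphX.
have evE p q c : p - q = c * ('X * 'X - 1) -> cong (ev p) (ev q).
  by move=> pq; rewrite /cong -rmorphB pq rmorphM rmorphB rmorphM evX rmorph1; apply: radicalMl.
have vvE : cong vv 0.
  apply: (@cong_trans _ (ev (1 *+ 4 + ('X * (1 - 'X)) *+ 2 + ((1 + 'X) * - 'X) *+ 2 + (1 + 'X) * (1 - 'X)))).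
    rewrite !(rmorphD, rmorphMn, rmorphM, rmorphB, rmorphN, rmorph1) /= evX /vv.
    have sgn : cong (1 - b') (1 + b).
      by apply: congD.
    have sgnM : cong ((1 - b') * b') ((1 + b) * - b) by apply: congM.
    rewrite !mulr2n; repeat first [exact: sgn | exact: sgnM | apply: congD | exact: cong_refl| apply: congM].
  by rewrite -(rmorph0 ev); apply: (evE _ _ (- 5%:R)); ring.
have rE : cong r (- b *+ 4).
  have -> : - b *+ 4 = h * 0 + (- b - b) *+ 2 by rewrite mulr0 add0r -mulr2n -mulrnA.
  rewrite /r !mulr2n; repeat first [exact: vvE | exact: b'E | apply: congD | exact: cong_refl| apply: congM].
have [r' rr'] : invertible r.
  apply: cong_invertible rE _; apply: (@invertible_left _ (- b)).
  apply: (@cong_invertible _ (2%:R ^+ 2)) => //.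
  have -> : - b *+ 4 * - b = (b * b) *+ 4 by rewrite mulrnAl mulrNN.
  have -> : (2%:R ^+ 2 : S) = 1 *+ 4 by rewrite expr2 -natrM.
  by rewrite !mulrS; repeat first [exact: bbE | apply: congD | exact: cong_refl].
exists r' => //.
have r'E : cong (r' *+ 4) (- b).
  rewrite -[- b]mulr1 -rr' mulrA; apply: cong_sym.
  apply: (@cong_trans _ (- b * (- b *+ 4) * r')).
    by repeat first [exact: rE | apply: congM | exact: cong_refl].
  rewrite mulrnAr mulrNN mulrnAl -[X in cong _ (X *+ _)]mul1r.
  by rewrite !mulrS; repeat first [exact: bbE | apply: congD | exact: cong_refl | apply: congM].
apply: (@invertible_right (2%:R ^+ 2)).
apply: (@cong_invertible _ (2%:R ^+ 3)) => //.
have -> : (2%:R ^+ 2 : S) = 1 *+ 4 by rewrite expr2 -natrM.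
have -> : 2%:R ^+ 3 = ev (8%:R) by rewrite rmorph_nat -natrX.
set t := b' *+ 2 + (1 - b); set u := 1 *+ 2 + (1 - b') * b'.
have tE : cong t (1 - b *+ 3).
  have -> : 1 - b *+ 3 = - b *+ 2 + (1 - b) by rewrite [RHS]addrCA mulrSr opprD mulNrn.
  by rewrite /t !mulr2n; repeat first [exact: b'E | apply: congD | exact: cong_refl].
have uE : cong u (1 *+ 2 + (1 + b) * - b).
  by rewrite /u; repeat first [exact: b'E | exact: b'N | apply: congD | exact: cong_refl | apply: congM].
have -> : 1 *+ 4 * (1 - (b' - t * r' * u)) = (1 - b') *+ 4 + t * (r' *+ 4) * u.
  by rewrite mulrnAl mul1r opprB addrA addrAC mulrnDl mulrnAr mulrnAl.
apply: (@cong_trans _ ((1 + b) *+ 4 + (1 - b *+ 3) * - b * (1 *+ 2 + (1 + b) * - b))).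
  clearbody t u; rewrite !(mulrS (_ + _)) !mulr0n.
  by repeat first [exact: tE | exact: uE | exact: r'E | exact: b'N | apply: congD | exact: cong_refl | apply: congM].
rewrite -evX -(rmorph1 ev) -!(rmorphMn, rmorphN, rmorphD, rmorphB, rmorphM).
by apply: (evE _ _ (4%:R - 'X *+ 2 - 'X * 'X *+ 3)); ring.
Qed.
End SymmetricDichotomy.

(** * Corner rings *)

Section Corner.
Variables (E : nzRingType) (e : E) (ee : e * e = e) (e0 : e != 0).

Definition corner_pred : pred E := fun x => e * x * e == x.

(** The proofs [ee] and [e0] are parameters of the type, for the ring instance to
    have [e] as its unit and to be nontrivial. *)
Record corner (ee : e * e = e) (e0 : e != 0) : predArgType :=
  Corner { cval :> E; _ : corner_pred cval }.
Local Notation S := (corner ee e0).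

Fact corner_zmod_closed : zmod_closed corner_pred.
Proof.
split=> [|x y]; rewrite !unfold_in /corner_pred ?mulr0 ?mul0r // => /eqP {2}<- /eqP {2}<-.
by rewrite mulrBr mulrBl.
Qed.

HB.instance Definition _ := GRing.isZmodClosed.Build E corner_pred corner_zmod_closed.
HB.instance Definition _ := [isSub of S for @cval ee e0].
HB.instance Definition _ := [Choice of S by <:].
HB.instance Definition _ := [SubChoice_isSubZmodule of S by <:].

Lemma cval_l (x : S) : e * cval x = cval x.
Proof. by case: x => x /= /eqP <-; rewrite !mulrA ee. Qed.
Lemma cval_r (x : S) : cval x * e = cval x.
Proof. by case: x => x /= /eqP <-; rewrite -!mulrA ee. Qed.

Fact corner_mul_subproof (x y : S) : corner_pred (cval x * cval y).
Proof. by rewrite /corner_pred mulrA cval_l -mulrA cval_r. Qed.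
Definition corner_mul (x y : S) : S := Corner ee e0 (corner_mul_subproof x y).
Fact corner_one_subproof : corner_pred e.
Proof. by rewrite /corner_pred !ee. Qed.
Definition corner_one : S := Corner ee e0 corner_one_subproof.

Fact corner_mulA : associative corner_mul.
Proof. by move=> x y z; apply: val_inj; rewrite /= mulrA. Qed.
Fact corner_mul1 : left_id corner_one corner_mul.
Proof. by move=> x; apply: val_inj; rewrite /= cval_l. Qed.
Fact corner_mulr1 : right_id corner_one corner_mul.
Proof. by move=> x; apply: val_inj; rewrite /= cval_r. Qed.
Fact corner_mulDl : left_distributive corner_mul +%R.
Proof. by move=> x y z; apply: val_inj; rewrite /= mulrDl. Qed.
Fact corner_mulDr : right_distributive corner_mul +%R.
Proof. by move=> x y z; apply: val_inj; rewrite /= mulrDr. Qed.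
Fact corner_one_neq0 : corner_one != 0.
Proof. by rewrite -val_eqE. Qed.

HB.instance Definition _ := GRing.Zmodule_isNzRing.Build S corner_mulA
  corner_mul1 corner_mulr1 corner_mulDl corner_mulDr corner_one_neq0.

Lemma cvalM (x y : S) : cval (x * y) = cval x * cval y. Proof. by []. Qed.
Lemma cval1 : cval (1 : S) = e. Proof. by []. Qed.
Lemma cvalD (x y : S) : cval (x + y) = cval x + cval y. Proof. by []. Qed.
Lemma cvalMn (x : S) n : cval (x *+ n) = cval x *+ n.
Proof. exact: (raddfMn val). Qed.

Lemma cornerP (x : E) : e * x = x -> x * e = x -> exists y : S, cval y = x.
Proof.
by move=> ex xe; have px : corner_pred x; [rewrite /corner_pred ex xe|exists (Corner ee e0 px)].
Qed.
End Corner.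

Section CornerInvolution.
Variables (E : nzRingType) (star : E -> E) (e : E).
Hypothesis inv_star : is_involution star.
Hypotheses (ee : e * e = e) (e0 : e != 0) (se : star e = e).
Local Notation S := (corner ee e0).

Definition corner_star (x : S) : S := insubd (0 : S) (star (cval x)).

Lemma cval_star x : cval (corner_star x) = star (cval x).
Proof.
rewrite [LHS]insubdK // unfold_in /corner_pred; apply/eqP.
have eze z : e * star z * e = star (e * z * e) by rewrite !(starM inv_star) se mulrA.
by rewrite eze cval_l cval_r.
Qed.

Lemma corner_inv_star : is_involution corner_star.
Proof.
split=> [x y|x y|x]; apply: val_inj; rewrite /= ?cvalD ?cvalM !cval_star.
- by rewrite -(starD inv_star) -cvalD.
- by rewrite -(starM inv_star) -cvalM.
- by rewrite (starK inv_star).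
Qed.

(** If z w = e in the corner, then z + (1 - e) and w + (1 - e) multiply to 1. *)
Lemma corner_dedekind_finite : dedekind_finite E -> dedekind_finite S.
Proof.
move=> DF x y xy.
have cross (z w : S) : (cval z + (1 - e)) * (cval w + (1 - e)) = cval (z * w) + (1 - e).
  have z0 : cval z * (1 - e) = 0 by rewrite mulrBr mulr1 cval_r subrr.
  have w0 : (1 - e) * cval w = 0 by rewrite mulrBl mul1r cval_l subrr.
  have e1 : (1 - e) * (1 - e) = 1 - e by rewrite mulrBr mulr1 mulrBl mul1r ee subrr subr0.
  move: (1 - e) z0 w0 e1 => f z0 w0 e1.
  by rewrite mulrDl !mulrDr z0 w0 e1 addr0 add0r.
apply: val_inj; apply: (addIr (1 - e)); rewrite -[LHS]cross; apply: etrans (DF _ _ _) _.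
  by rewrite cross xy addrC subrK.
by rewrite addrC subrK.
Qed.
End CornerInvolution.

(** * Quasi-reflections and Witt extension *)

Section Unitary.
Variables (E : nzRingType) (star : E -> E).
Hypothesis inv_star : is_involution star.
Local Notation "x ^*" := (star x) : ring_scope.
Implicit Types (e u v r c : E).

Definition symmetric_idempotent e := e * e = e /\ e^* = e.

Definition unitary (t : E) := t^* * t = 1 /\ t * t^* = 1.

Lemma unitaryM s t : unitary s -> unitary t -> unitary (s * t).
Proof.
move=> [s1 s2] [t1 t2]; split; rewrite (starM inv_star).
  by rewrite mulrA -(mulrA t^*) s1 mulr1.
by rewrite mulrA -(mulrA s) t2 mulr1.
Qed.

Lemma unitary_fix t c : unitary t -> t * c = c -> t^* * c = c.
Proof. by move=> [t1 _] tc; rewrite -{1}tc mulrA t1 mul1r. Qed.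

(** Witt's extension property: the partial isometry [u] with source [e] extends
    to a unitary. The last clause, triviality on what is orthogonal to both [e]
    and [u], is what allows extensions to be combined. *)
Definition witt_extension e := forall u, u^* * u = e -> u * e = u ->
  exists t, [/\ unitary t, t * e = u & forall c, e * c = 0 -> u^* * c = 0 -> t * c = c].

(** First extend u e1, to t1 say. Then t1^* u e2 is an isometric copy of [e2]
    orthogonal to [e1], so that its extension fixes [e1]. *)
Lemma witt_extensionD e1 e2 : symmetric_idempotent e1 -> symmetric_idempotent e2 ->
  e1 * e2 = 0 -> witt_extension e1 -> witt_extension e2 -> witt_extension (e1 + e2).
Proof.
move=> [e11 se1] [e22 se2] e12 W1 W2 u uu ue.
have e21 : e2 * e1 = 0 by rewrite -se1 -se2 -(starM inv_star) e12 (star0 inv_star).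
have uue1 : (u * e1)^* * (u * e1) = e1.
  rewrite (starM inv_star) se1 mulrA -(mulrA e1) uu mulrDr e12 addr0.
  by rewrite e11.
have [t1 [t1U t1e t1c]] := W1 (u * e1) uue1 (etrans (esym (mulrA _ _ _)) (congr1 _ e11)).
pose u2 := t1^* * u * e2.
have u2u2 : u2^* * u2 = e2.
  rewrite /u2 !(starM inv_star) se2 (starK inv_star) -!mulrA (mulrA t1) t1U.2 mul1r.
  by rewrite (mulrA u^*) uu mulrDl e12 add0r e22.
have u2e1 : u2^* * e1 = 0.
  rewrite /u2 !(starM inv_star) se2 (starK inv_star) -!mulrA t1e (mulrA u^*) uu mulrDl e21.
  by rewrite addr0 e11 e21.
have [t2 [t2U t2e t2c]] := W2 u2 u2u2 (etrans (esym (mulrA _ _ _)) (congr1 _ e22)).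
exists (t1 * t2); split; first exact: unitaryM.
  rewrite mulrDr -!mulrA t2e t2c // t1e /u2 !mulrA t1U.2 mul1r -mulrDr ue //.
move=> c ec uc.
have e1c : e1 * c = 0.
  by move: (congr1 (fun z => e1 * z) ec); rewrite mulr0 mulrA mulrDr e11 e12 addr0.
have e2c : e2 * c = 0.
  by move: (congr1 (fun z => e2 * z) ec); rewrite mulr0 mulrA mulrDr e22 e21 add0r.
have tc : t1 * c = c by apply: t1c => //; rewrite (starM inv_star) se1 -mulrA uc mulr0.
rewrite -mulrA t2c // /u2 !(starM inv_star) se2 (starK inv_star) -!mulrA tc uc mulr0 //.
Qed.

(** The usual reflection along v has r = v^* v / 2; any invertible r with
    r + r^* = v^* v does, as this is what cancels the terms of t^* t - 1. The
    freedom to add a skew element to r is what makes it invertible later on. *)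
Lemma quasi_reflection e v r r' : e^* = e -> v * e = v -> e * r' = r' -> r' * e = r' ->
  r * r' = e -> r' * r = e -> r + r^* = v^* * v ->
  unitary (1 - v * r' * v^*) /\ (forall c, v^* * c = 0 -> (1 - v * r' * v^*) * c = c).
Proof.
move=> se ve er' r'e rr' r'r rv; set t := 1 - _.
have ts : t^* = 1 - v * r'^* * v^*.
  by rewrite /t (starB inv_star) (star1 inv_star) !(starM inv_star) (starK inv_star) mulrA.
have r'sr : r'^* * r^* = e by rewrite -(starM inv_star) rr'.
have r'se : r'^* * e = r'^* by rewrite -[e]se -(starM inv_star) er'.
have er's : e * r'^* = r'^* by rewrite -[e]se -(starM inv_star) r'e.
have prod (p q : E) : (1 - v * p * v^*) * (1 - v * q * v^*) =
    1 - (v * (p + q - p * (r + r^*) * q) * v^*).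
  rewrite rv mulrBr mulr1 mulrBl mul1r -addrA -opprD; congr (1 - _).
  rewrite !(mulrBr, mulrBl) !(mulrDr, mulrDl) !mulrA addrA.
  by rewrite -addrA -opprB opprD.
have [t1 t2] : t^* * t = 1 /\ t * t^* = 1.
  rewrite ts /t !prod.
  have -> : r'^* + r' - r'^* * (r + r^*) * r' = 0.
    by rewrite mulrDr r'sr mulrDl -mulrA rr' r'se er' subrr.
  have -> : r' + r'^* - r' * (r + r^*) * r'^* = 0.
    by rewrite mulrDr r'r mulrDl er's -mulrA -(starM inv_star) r'r se r'e [r' + _]addrC subrr.
  by rewrite mulr0 mul0r subr0.
split=> // c vc; by rewrite mulrBl mul1r -!mulrA vc !mulr0 subr0.
Qed.

(** Reflect along v = x - y: as v^* x = e - y^* x is the [r] of this reflection,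
    [x] goes to x - v = y. *)
Lemma reflection_swap e x y r' : e^* = e -> x * e = x -> y * e = y ->
  x^* * x = e -> y^* * y = e -> e * r' = r' -> r' * e = r' ->
  (e - y^* * x) * r' = e -> r' * (e - y^* * x) = e ->
  exists t, [/\ unitary t, t * x = y & forall c, x^* * c = 0 -> y^* * c = 0 -> t * c = c].
Proof.
move=> se xe ye xx yy er' r'e rr' r'r; pose r := e - y^* * x; pose v := x - y.
have ve : v * e = v by rewrite mulrBl xe ye.
have vx : v^* * x = r by rewrite (starB inv_star) mulrBl xx.
have rv : r + r^* = v^* * v.
  have vy : v^* * y = x^* * y - e by rewrite (starB inv_star) mulrBl yy.
  have -> : v^* * v = v^* * x - v^* * y by rewrite -mulrBr.
  rewrite vx vy opprB; congr (_ + _).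
  by rewrite (starB inv_star) (starM inv_star) (starK inv_star) se.
have [tU tc] := quasi_reflection se ve er' r'e rr' r'r rv.
exists (1 - v * r' * v^*); split=> //.
  by rewrite mulrBl mul1r -!mulrA vx r'r ve opprB addrC subrK.
by move=> c xc yc; apply: tc; rewrite (starB inv_star) mulrBl xc yc subrr.
Qed.

Section Minimal.
Hypothesis DF : dedekind_finite E.
Variable h : E.
Hypotheses (h2 : h *+ 2 = 1) (hC : forall x, h * x = x * h).
Variable e : E.
Hypotheses (ee : e * e = e) (se : e^* = e) (e0 : e != 0).
Local Notation S := (corner ee e0).
Local Notation sstar := (@corner_star E star e ee e0).
Hypothesis dichotomy :
  forall a : S, sstar a = a -> invertible a \/ invertible (1 - a).

(** The quasi-reflections are those announced by [reflection_trichotomy]; when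
    they start from - e, they are preceded by 1 - 2 e, which takes [e] to - e. *)
Lemma minimal_witt_extension : witt_extension e.
Proof.
move=> u uu ue.
have inv_sstar : is_involution sstar by apply: corner_inv_star.
have DFS : dedekind_finite S by apply: corner_dedekind_finite.
have [hS hSE] : exists y : S, cval y = h * e.
  by apply: cornerP; rewrite -?mulrA ?ee // mulrA -hC -mulrA ee.
have hS2 : hS *+ 2 = 1.
  by apply: val_inj; rewrite [LHS]cvalMn hSE -mulrnAl h2 mul1r.
have eue : exists y : S, cval y = e * u.
  by apply: cornerP; rewrite ?mulrA ?ee // -mulrA ue.
have [b bE] := eue.
have sb : cval (sstar b) = u^* * e.
  by rewrite (cval_star inv_star se) bE (starM inv_star) se.
have eus : e * u^* = u^* by rewrite -[e]se -(starM inv_star) ue.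
have cvalB (x y : S) : cval (x - y) = cval x - cval y by [].
have eS (x : S) : e * cval x = cval x by rewrite cval_l.
have Se (x : S) : cval x * e = cval x by rewrite cval_r.
have inv2 (x : S) : invertible x -> exists2 y : S, cval x * cval y = e & cval y * cval x = e.
  move=> [y xy]; exists y; first by rewrite -cvalM xy.
  by rewrite -cvalM (DFS _ _ xy).
have [Ub|Ub|[r' rr' Ub]] := reflection_trichotomy inv_sstar DFS hS2 dichotomy b.
- have [z z1 z2] := inv2 _ (invertible_star inv_sstar DFS Ub).
  have zE : cval (sstar (1 - b)) = e - u^* * e.
    by rewrite (starB inv_sstar) (star1 inv_sstar) cvalB sb.
  rewrite zE in z1 z2.
  have see : e^* * e = e by rewrite se.
  have [t [tU te tc]] := reflection_swap se ee ue see uu (eS z) (Se z) z1 z2.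
  by exists t; split=> // c ec uc; apply: tc => //; rewrite se.
- have [z z1 z2] := inv2 _ (invertible_star inv_sstar DFS Ub).
  have zE : cval (sstar (1 + b)) = e - u^* * - e.
    by rewrite (starD inv_sstar) (star1 inv_sstar) cvalD sb mulrN opprK.
  rewrite zE in z1 z2.
  have Nee : - e * e = - e by rewrite mulNr ee.
  have sNee : (- e)^* * - e = e by rewrite (starN inv_star) se mulrNN.
  have [t [tU te tc]] := reflection_swap se Nee ue sNee uu (eS z) (Se z) z1 z2.
  have fU : unitary (1 - e *+ 2).
    have sf : (1 - e *+ 2)^* = 1 - e *+ 2.
      by rewrite (starB inv_star) (star1 inv_star) (starMn inv_star) se.
    suff ff : (1 - e *+ 2) * (1 - e *+ 2) = 1 by split; rewrite sf.
    have : e *+ 2 * (e *+ 2) = e *+ 2 + e *+ 2 by rewrite mulrnAl mulrnAr ee [LHS]mulr2n.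
    move: (e *+ 2) => f ff.
    by rewrite mulrBr mulr1 mulrBl mul1r ff opprB addrK subrK.
  exists (t * (1 - e *+ 2)); split; first exact: unitaryM.
    by rewrite -mulrA mulrBl mul1r mulrnAl ee mulr2n opprD addrA subrr add0r.
  move=> c ec uc; rewrite -mulrA mulrBl mul1r mulrnAl ec mul0rn subr0.
  by apply: tc => //; rewrite (starN inv_star) se mulNr ec oppr0.
- set vv := (1 *+ 4 + _ + _ + _) in rr'; set r := hS * vv + _ in rr'.
  have svb : sstar vv = vv.
    have sA : sstar ((b * (1 - b)) *+ 2) = ((1 - sstar b) * sstar b) *+ 2.
      by rewrite [LHS](starMn inv_sstar) (starM inv_sstar) (starB inv_sstar) (star1 inv_sstar).
    have sC : sstar ((1 - sstar b) * (1 - b)) = (1 - sstar b) * (1 - b).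
      by rewrite (starM inv_sstar) !(starB inv_sstar) (starK inv_sstar) (star1 inv_sstar).
    have s4 : sstar (1 *+ 4) = 1 *+ 4 by rewrite [LHS](starMn inv_sstar) (star1 inv_sstar).
    have sB : sstar (((1 - sstar b) * sstar b) *+ 2) = (b * (1 - b)) *+ 2.
      by rewrite -sA (starK inv_sstar).
    rewrite /vv; move: s4 sA sB sC; move: (1 *+ 4) ((b * (1 - b)) *+ 2)
      (((1 - sstar b) * sstar b) *+ 2) ((1 - sstar b) * (1 - b)) => x1 x2 x3 x4 s4 sA sB sC.
    by rewrite !(starD inv_sstar) s4 sA sB sC [x1 + _ + _]addrAC.
  have shS : sstar hS = hS.
    have : (sstar hS - hS) *+ 2 = 0.
      by rewrite mulrnBl -(starMn inv_sstar) hS2 (star1 inv_sstar) subrr.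
    move=> /(congr1 (fun z => hS * z)); rewrite mulr0 mulrnAr -mulrnAl hS2 mul1r => /eqP.
    by rewrite subr_eq0 => /eqP.
  have hSC x : hS * x = x * hS.
    by apply: val_inj; rewrite [LHS]cvalM [RHS]cvalM hSE -[LHS]mulrA eS [RHS]mulrA -hC -[RHS]mulrA Se.
  have rsr : r + sstar r = vv.
    rewrite /r (starD inv_sstar) (starM inv_sstar) svb shS (starMn inv_sstar) (starB inv_sstar) (starK inv_sstar).
    by rewrite -hSC addrACA -mulrnDl -opprB addNr mul0rn addr0 -mulr2n -mulrnAl hS2 mul1r.
  have r'r := DFS _ _ rr'.
  pose v := e *+ 2 + u * (e - e * u).
  have ve : v * e = v by rewrite mulrDl mulrnAl ee -mulrA mulrBl ee -mulrA ue.
  have vs : v^* = e *+ 2 + (e - u^* * e) * u^*.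
    by rewrite (starD inv_star) (starMn inv_star) !(starM inv_star) (starB inv_star) (starM inv_star) se.
  have vv_E : v^* * v = cval vv.
    transitivity (cval (1 *+ 4 : S) + cval ((b * (1 - b)) *+ 2) +
        cval (((1 - sstar b) * sstar b) *+ 2) + cval ((1 - sstar b) * (1 - b))); last by [].
    rewrite (cvalMn 1 4) (cvalMn (b * (1 - b)) 2) (cvalMn ((1 - sstar b) * sstar b) 2).
    rewrite !cvalM !cvalB sb bE cval1 vs.
    have qe : (e - u^* * e) * e = e - u^* * e by rewrite mulrBl -mulrA ee.
    rewrite /v; move: (e - u^* * e) (e - e * u) qe => q p qe.
    have e2l y : e *+ 2 * y = (e * y) *+ 2 by rewrite mulrnAl.
    have e2r y : y * (e *+ 2) = (y * e) *+ 2 by rewrite mulrnAr.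
    have e22 : e *+ 2 * (e *+ 2) = e *+ 4 by rewrite mulrnAl mulrnAr ee -mulrnA.
    move: (e *+ 2) e2l e2r e22 => e2 e2l e2r e22.
    rewrite mulrDl !mulrDr addrA e22 e2l e2r -!mulrA (mulrA u^*) uu.
    by rewrite [q * (e * p)]mulrA qe !addrA.
  have vvr : cval r + (cval r)^* = v^* * v by rewrite -(cval_star inv_star se) vv_E -rsr.
  have rr'E : cval r * cval r' = e by rewrite -cvalM rr'.
  have r'rE : cval r' * cval r = e by rewrite -cvalM r'r.
  have [wU wc] := quasi_reflection se ve (eS r') (Se r') rr'E r'rE vvr.
  set w := 1 - _ in wU wc.
  have we : w * e * e = w * e by rewrite -mulrA ee.
  have wewe : (w * e)^* * (w * e) = e.
    by rewrite (starM inv_star) se mulrA -(mulrA e) wU.1 mulr1 ee.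
  have [z z1 z2] := inv2 _ Ub.
  have zE : cval (1 - (sstar b - (sstar b *+ 2 + (1 - b)) * r' * (1 *+ 2 + (1 - sstar b) * sstar b))) = e - u^* * (w * e).
    transitivity (e - (cval (sstar b) - (cval (sstar b *+ 2) + cval (1 - b)) * cval r' *
        (cval (1 *+ 2 : S) + cval ((1 - sstar b) * sstar b)))); first by [].
    rewrite (cvalMn (sstar b) 2) (cvalMn 1 2) !cvalM !cvalB sb bE cval1.
    have -> : (u^* * e) *+ 2 + (e - e * u) = u^* * v.
      by rewrite /v mulrDr mulrnAr [u^* * (u * _)]mulrA uu mulrBr ee mulrA ee.
    have -> : e *+ 2 + (e - u^* * e) * (u^* * e) = v^* * e.
      by rewrite vs [RHS]mulrDl mulrnAl ee mulrA.
    congr (_ - _); rewrite /w mulrBl mul1r mulrBr; congr (_ - _).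
    by rewrite !mulrA.
  rewrite zE in z1 z2.
  have [t [tU te tc]] := reflection_swap se we ue wewe uu (eS z) (Se z) z1 z2.
  exists (t * w); split; first exact: unitaryM.
    by rewrite -mulrA.
  move=> c ec uc.
  have wcc : w * c = c by apply: wc; rewrite vs mulrDl mulrnAl ec mul0rn add0r -mulrA uc mulr0.
  rewrite -mulrA wcc; apply: tc => //.
  by rewrite (starM inv_star) se -mulrA (unitary_fix wU wcc).
Qed.
End Minimal.
End Unitary.

Section AlgebraWithInvolution.
Variables (R : comUnitRingType) (E : algType R) (star : E -> E).
Hypothesis inv_star : is_involution star.
Hypothesis starZ : forall (c : R) x, star (c *: x) = c *: star x.
Hypothesis two_unit : (2%:R : R) \is a GRing.unit.
Hypothesis DF : dedekind_finite E.
Hypothesis splitting : forall a : E, exists eps al be : {poly R},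
  [/\ horner_alg a (eps * eps) = horner_alg a eps,
      horner_alg a (al * 'X) = horner_alg a eps
    & horner_alg a (be * (1 - 'X)) = horner_alg a (1 - eps)].

Lemma star_horner_alg a p : star a = a -> star (horner_alg a p) = horner_alg a p.
Proof.
move=> sa; elim/poly_ind: p => [|p c IHp]; first by rewrite rmorph0 (star0 inv_star).
rewrite rmorphD rmorphM /= horner_algX horner_algC (starD inv_star) (starM inv_star) IHp sa.
rewrite starZ (star1 inv_star); congr (_ + _).
by rewrite -{1 4}[a]horner_algX -!rmorphM mulrC.
Qed.

Lemma comm_horner_alg (e a : E) p : e * a = a * e -> e * horner_alg a p = horner_alg a p * e.
Proof.
move=> ea; elim/poly_ind: p => [|p c IHp]; first by rewrite rmorph0 mulr0 mul0r.
rewrite rmorphD rmorphM /= horner_algX horner_algC mulrDr mulrDl mulr_algr mulr_algl.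
by rewrite mulrA IHp -[_ * e * a]mulrA ea mulrA.
Qed.

Definition minimal_idempotent (e : E) := e != 0 /\
  forall f, symmetric_idempotent star f -> e * f = f -> f = 0 \/ f = e.

(** The splitting idempotent of [a] is a polynomial in [a], hence symmetric and
    commuting with [e]; cut down by the minimal [e], it is 0 or [e]. *)
Lemma minimal_dichotomy e (ee : e * e = e) (e0 : e != 0) : star e = e ->
  minimal_idempotent e -> forall a : corner ee e0, corner_star star a = a ->
  invertible a \/ invertible (1 - a).
Proof.
move=> se [_ emin] a sa; set a' := cval a.
have sa' : star a' = a' by rewrite -(cval_star inv_star se) sa.
have ea : e * a' = a' * e by rewrite cval_l cval_r.
have [eps [al [be [epsK alE beE]]]] := splitting a'.
have comm p := comm_horner_alg p ea; have sev p := star_horner_alg p sa'.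
rewrite !rmorphM /= horner_algX in epsK alE; rewrite rmorphM !rmorphB !rmorph1 /= horner_algX in beE.
pose f := e * horner_alg a' eps.
have fP : symmetric_idempotent star f.
  split; last by rewrite (starM inv_star) se sev -comm.
  by rewrite /f {1}comm -mulrA (mulrA e) ee comm mulrA epsK -comm.
have toC (x : E) : e * x = x * e -> exists y : corner ee e0, cval y = e * x.
  by move=> ex; apply: cornerP; rewrite ?mulrA ?ee // -mulrA -ex mulrA ee.
have XC p : horner_alg a' p * a' = a' * horner_alg a' p.
  by rewrite -{2 3}[a']horner_algX -!rmorphM mulrC.
case: (emin f fP); first by rewrite /f mulrA ee.
- move=> f0; right; have [y yE] := toC _ (comm be); exists y.
  apply: val_inj; rewrite [LHS](cvalM (1 - a) y) yE.
  have -> : cval (1 - a) = e * (1 - a') by rewrite mulrBr mulr1 cval_l.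
  have e1a : e * (1 - a') = (1 - a') * e by rewrite mulrBr mulrBl mulr1 mul1r ea.
  rewrite e1a -mulrA (mulrA e e) ee comm mulrA.
  have -> : (1 - a') * horner_alg a' be = horner_alg a' be * (1 - a').
    by rewrite mulrBl mulrBr mul1r mulr1 XC.
  by rewrite beE mulrBl mul1r -comm -/f f0 subr0.
- move=> fe; left; have [y yE] := toC _ (comm al); exists y.
  apply: val_inj; rewrite [LHS](cvalM a y) yE -/a'.
  by rewrite mulrA -ea -mulrA -XC alE.
Qed.

Lemma witt_extension0 : witt_extension star 0.
Proof.
move=> u _ u0; exists 1; split; first by split; rewrite (star1 inv_star) mulr1.
  by rewrite mulr0 -u0 mulr0.
by move=> c _ _; rewrite mul1r.
Qed.

Lemma minimal_witt e : symmetric_idempotent star e -> minimal_idempotent e ->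
  witt_extension star e.
Proof.
move=> [ee se] emin; have e0 := emin.1.
have h2 : (2%:R^-1 : R)%:A *+ 2 = 1 :> E.
  by rewrite -scaler_nat scalerA mulrV // scale1r.
apply: (minimal_witt_extension inv_star DF h2 _ se) => [x|].
  by rewrite mulr_algl mulr_algr.
exact: (@minimal_dichotomy e ee e0).
Qed.

Lemma symmetric_idempotentB e f : symmetric_idempotent star e ->
  symmetric_idempotent star f -> e * f = f -> symmetric_idempotent star (e - f).
Proof.
move=> [ee se] [ff sf] ef; have fe : f * e = f.
  by rewrite -sf -{1}se -(starM inv_star) ef.
split; last by rewrite (starB inv_star) se sf.
by rewrite mulrBl !mulrBr ee ef fe ff subrr subr0.
Qed.

(** If the property fails for [e] then [e] is not minimal, and splits into two
    orthogonal symmetric idempotents. By additivity it fails for one of them,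
    which is split in turn, while the other is kept. *)
Lemma witt_extension_failure l e : symmetric_idempotent star e ->
  ~ witt_extension star e -> exists f : 'I_l -> E,
  [/\ forall i, symmetric_idempotent star (f i), forall i, f i != 0,
      forall i, e * f i = f i & forall i j, i != j -> f i * f j = 0].
Proof.
elim: l e => [|l IHl] e eP We; first by exists (fun=> 0); split; case.
have e0 : e != 0 by apply/eqP => e0; apply: We; rewrite e0; apply: witt_extension0.
have [g [gP eg g0 ge]] : exists g, [/\ symmetric_idempotent star g, e * g = g, g <> 0 & g <> e].
  apply: contrapT => noG; apply: We; apply: minimal_witt => //; split=> // f fP ef.
  have [f0|f0] := pselect (f = 0); first by left.
  have [fe|fe] := pselect (f = e); first by right.
  by case: noG; exists f.
wlog Wg : g gP eg g0 ge / ~ witt_extension star g => [wlogW|].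
  have [Wg|Wg] := pselect (witt_extension star g); last exact: (wlogW g).
  have gP' := symmetric_idempotentB eP gP eg.
  have eg' : e * (e - g) = e - g by rewrite mulrBr eP.1 eg.
  apply: (wlogW (e - g)) => //.
  - by move/eqP; rewrite subr_eq0 => /eqP/esym.
  - by move=> /(congr1 (fun z => e - z)); rewrite opprB addrC subrK subrr => /g0.
  - move=> Wg'; apply: We; rewrite -(subrK g e) addrC.
    by apply: witt_extensionD => //; rewrite mulrBr gP.1 -{1}gP.2 -{1}eP.2 -(starM inv_star) eg gP.2 subrr.
have [f [fP f0 gf ff]] := IHl g gP Wg.
pose f' (i : 'I_l.+1) := if unlift ord0 i is Some j then f j else e - g.
have ef j : e * f j = f j by rewrite -gf mulrA eg.
have egf j : (e - g) * f j = 0 by rewrite mulrBl ef gf subrr.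
have egP := symmetric_idempotentB eP gP eg.
exists f'; rewrite /f'; split=> [i|i|i|i j].
- by case: unliftP.
- case: unliftP => [j _|_] //; apply/eqP => /eqP; rewrite subr_eq0 => /eqP/esym.
  exact: ge.
- by case: unliftP => [j _|_] //; rewrite mulrBr eP.1 eg.
- case: unliftP => [i' ->|->]; case: unliftP => [j' ->|->] //.
  + by rewrite (inj_eq lift_inj); apply: ff.
  + by move=> _; rewrite -(fP i').2 -egP.2 -(starM inv_star) egf (star0 inv_star).
Qed.

Theorem symmetric_idempotent_witt l e :
  (forall f : 'I_l -> E, (forall i, symmetric_idempotent star (f i)) ->
    (forall i j, i != j -> f i * f j = 0) -> exists i, f i = 0) ->
  symmetric_idempotent star e -> witt_extension star e.
Proof.
move=> bound eP; apply: contrapT => We.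
have [f [fP f0 _ ff]] := witt_extension_failure l eP We.
by have [i fi] := bound f fP ff; move: (f0 i); rewrite fi eqxx.
Qed.

End AlgebraWithInvolution.

(** * The ring of adjoint pairs *)

Section AdjointRing.
Variables (R : comUnitRingType) (A : algType R) (I : Type) (sigma : I -> A -> A).
Hypothesis hsigma : forall i, R_involution (sigma i).
Variables (M : lmodType A^c) (h : I -> M -> M -> A).
Hypothesis hh : forall i, sesquilinear (sigma i) (h i).
Variables (x0 : M) (x0N : x0 != 0).

Definition rscale (c : R) (x : M) : M := (c%:A : A^c) *: x.

Lemma rscaleDr c x y : rscale c (x + y) = rscale c x + rscale c y.
Proof. exact: scalerDr. Qed.
Lemma rscaleDl c d x : rscale (c + d) x = rscale c x + rscale d x.
Proof. by rewrite /rscale -scalerDl; congr (_ *: _); apply: scalerDl. Qed.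
Lemma rscaleA c d x : rscale c (rscale d x) = rscale (c * d) x.
Proof.
rewrite /rscale scalerA; congr (_ *: _).
by rewrite -[LHS]/((d%:A : A) * c%:A) mulr_algl scalerA mulrC.
Qed.
Lemma rscale1 x : rscale 1 x = x.
Proof. by rewrite /rscale scale1r; apply: scale1r. Qed.
Lemma rscale_linear c : linear (rscale c).
Proof.
move=> a x y; rewrite rscaleDr; congr (_ + _); rewrite /rscale !scalerA; congr (_ *: _).
exact: etrans (mulr_algr _ _) (esym (mulr_algl _ _)).
Qed.

Lemma form_rscale_l i c x y : h i (rscale c x) y = c *: h i x y.
Proof.
have [_ _ sesq] := hh i; have [lin s1 _ _] := hsigma i.
have sc : sigma i c%:A = c%:A.
  have lin0 : sigma i 0 = 0.
    by have := lin (- 1) 0 0; rewrite scaler0 addr0 scaleN1r addNr.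
  by have := lin c 1 0; rewrite addr0 s1 lin0 addr0.
by rewrite -[y in LHS](scale1r y) [LHS](sesq x y c%:A 1) sc mulr1 mulr_algl.
Qed.

Lemma form_rscale_r i c x y : h i x (rscale c y) = c *: h i x y.
Proof.
have [_ _ sesq] := hh i; have [_ s1 _ _] := hsigma i.
by rewrite -[x in LHS](scale1r x) [LHS](sesq x y 1 c%:A) s1 mul1r mulr_algr.
Qed.

Lemma formDl i x x' y : h i (x + x') y = h i x y + h i x' y.
Proof. by case: (hh i). Qed.
Lemma formDr i x y y' : h i x (y + y') = h i x y + h i x y'.
Proof. by case: (hh i). Qed.
Lemma form0l i y : h i 0 y = 0.
Proof. by apply: (addrI (h i 0 y)); rewrite -formDl !addr0. Qed.
Lemma form0r i x : h i x 0 = 0.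
Proof. by apply: (addrI (h i x 0)); rewrite -formDr !addr0. Qed.
Lemma formNl i x y : h i (- x) y = - h i x y.
Proof. by apply/eqP; rewrite -addr_eq0 -formDl addNr form0l. Qed.
Lemma formNr i x y : h i x (- y) = - h i x y.
Proof. by apply/eqP; rewrite -addr_eq0 -formDr addNr form0r. Qed.

(** As the forms may be degenerate, an adjoint need neither exist nor be unique:
    it is part of the data. Exchanging the components is the involution. The
    point [x1] makes the ring nontrivial. *)
Record adjoint (hs : forall i, R_involution (sigma i))
    (hf : forall i, sesquilinear (sigma i) (h i)) (x1 : M) (x1N : x1 != 0) := Adjoint {
  fwd : M -> M;
  bwd : M -> M;
  fwd_linear : linear fwd;
  bwd_linear : linear bwd;
  fwd_bwd : forall i x y, h i (fwd x) y = h i x (bwd y);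
  bwd_fwd : forall i x y, h i (bwd x) y = h i x (fwd y) }.
Local Notation E := (adjoint hsigma hh x0N).

Lemma adjointP (f g : E) : fwd f =1 fwd g -> bwd f =1 bwd g -> f = g.
Proof.
case: f g => [f1 f2 f3 f4 f5 f6] [g1 g2 g3 g4 g5 g6] /= /funext E1 /funext E2.
move: f3 f4 f5 f6; rewrite E1 E2 => f3 f4 f5 f6.
by congr Adjoint; apply: Prop_irrelevance.
Qed.

HB.instance Definition _ := gen_eqMixin E.
HB.instance Definition _ := gen_choiceMixin E.

Fact zero_linear : linear (fun _ : M => 0 : M).
Proof. by move=> a x y; rewrite scaler0 addr0. Qed.
Definition adj0 : E.
Proof. by exists (fun=> 0) (fun=> 0); [exact: zero_linear|exact: zero_linear|..] => i x y; rewrite form0l form0r. Defined.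

Definition adj1 : E. Proof. by exists id id. Defined.

Definition adjN (f : E) : E.
Proof.
exists (fun x => - fwd f x) (fun x => - bwd f x).
- by move=> a x y; rewrite fwd_linear opprD scalerN.
- by move=> a x y; rewrite bwd_linear opprD scalerN.
- by move=> i x y; rewrite formNl formNr fwd_bwd.
- by move=> i x y; rewrite formNl formNr bwd_fwd.
Defined.

Definition adjD (f g : E) : E.
Proof.
exists (fun x => fwd f x + fwd g x) (fun x => bwd f x + bwd g x).
- by move=> a x y; rewrite !fwd_linear scalerDr addrACA.
- by move=> a x y; rewrite !bwd_linear scalerDr addrACA.
- by move=> i x y; rewrite formDl formDr !fwd_bwd.
- by move=> i x y; rewrite formDl formDr !bwd_fwd.
Defined.

Definition adjM (f g : E) : E.
Proof.
exists (fun x => fwd f (fwd g x)) (fun x => bwd g (bwd f x)).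
- by move=> a x y; rewrite !fwd_linear.
- by move=> a x y; rewrite !bwd_linear.
- by move=> i x y; rewrite !fwd_bwd.
- by move=> i x y; rewrite !bwd_fwd.
Defined.

Definition adjZ (c : R) (f : E) : E.
Proof.
exists (fun x => rscale c (fwd f x)) (fun x => rscale c (bwd f x)).
- by move=> a x y; rewrite fwd_linear rscale_linear.
- by move=> a x y; rewrite bwd_linear rscale_linear.
- by move=> i x y; rewrite form_rscale_l form_rscale_r fwd_bwd.
- by move=> i x y; rewrite form_rscale_l form_rscale_r bwd_fwd.
Defined.

Definition adjS (f : E) : E := Adjoint hsigma hh x0N (bwd_linear f) (fwd_linear f) (bwd_fwd f) (fwd_bwd f).

Fact adj_addA : associative adjD.
Proof. by move=> f g k; apply: adjointP => x /=; rewrite addrA. Qed.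
Fact adj_addC : commutative adjD.
Proof. by move=> f g; apply: adjointP => x /=; rewrite addrC. Qed.
Fact adj_add0 : left_id adj0 adjD.
Proof. by move=> f; apply: adjointP => x /=; rewrite add0r. Qed.
Fact adj_addN : left_inverse adj0 adjN adjD.
Proof. by move=> f; apply: adjointP => x /=; rewrite addNr. Qed.
HB.instance Definition _ := GRing.isZmodule.Build E adj_addA adj_addC adj_add0 adj_addN.

Lemma fwdD f x y : fwd (f : E) (x + y) = fwd f x + fwd f y.
Proof. by rewrite -[x]scale1r fwd_linear !scale1r. Qed.
Lemma bwdD f x y : bwd (f : E) (x + y) = bwd f x + bwd f y.
Proof. by rewrite -[x]scale1r bwd_linear !scale1r. Qed.
Lemma fwd0 f : fwd (f : E) 0 = 0.
Proof. by apply: (addrI (fwd f 0)); rewrite -fwdD !addr0. Qed.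
Lemma bwd0 f : bwd (f : E) 0 = 0.
Proof. by apply: (addrI (bwd f 0)); rewrite -bwdD !addr0. Qed.
Lemma fwdZ f a x : fwd (f : E) (a *: x) = a *: fwd f x.
Proof. by rewrite -[a *: x]addr0 fwd_linear fwd0 addr0. Qed.
Lemma bwdZ f a x : bwd (f : E) (a *: x) = a *: bwd f x.
Proof. by rewrite -[a *: x]addr0 bwd_linear bwd0 addr0. Qed.

Fact adj_mulA : associative adjM.
Proof. by move=> f g k; apply: adjointP. Qed.
Fact adj_mul1 : left_id adj1 adjM.
Proof. by move=> f; apply: adjointP. Qed.
Fact adj_mulr1 : right_id adj1 adjM.
Proof. by move=> f; apply: adjointP. Qed.
Fact adj_mulDl : left_distributive adjM +%R.
Proof. by move=> f g k; apply: adjointP => x //=; rewrite bwdD. Qed.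
Fact adj_mulDr : right_distributive adjM +%R.
Proof. by move=> f g k; apply: adjointP => x //=; rewrite fwdD. Qed.
Fact adj_one_neq0 : adj1 != 0 :> E.
Proof.
apply/eqP => /(congr1 (fun f => fwd f x0)) /= => x00.
by move: x0N; rewrite x00 eqxx.
Qed.
HB.instance Definition _ := GRing.Zmodule_isNzRing.Build E adj_mulA adj_mul1
  adj_mulr1 adj_mulDl adj_mulDr adj_one_neq0.

Fact adj_scaleA a b f : adjZ a (adjZ b f) = adjZ (a * b) f.
Proof. by apply: adjointP => x /=; rewrite rscaleA. Qed.
Fact adj_scale1 : left_id 1 adjZ.
Proof. by move=> f; apply: adjointP => x /=; rewrite rscale1. Qed.
Fact adj_scaleDr : right_distributive adjZ +%R.
Proof. by move=> a f g; apply: adjointP => x /=; rewrite rscaleDr. Qed.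
Fact adj_scaleDl f : {morph adjZ^~ f : a b / a + b}.
Proof. by move=> a b; apply: adjointP => x /=; rewrite rscaleDl. Qed.
HB.instance Definition _ := GRing.Zmodule_isLmodule.Build R E adj_scaleA adj_scale1
  adj_scaleDr adj_scaleDl.

Fact adj_scaleAl (a : R) (f g : E) : a *: (f * g) = (a *: f) * g.
Proof. by apply: adjointP => x //=; rewrite /rscale bwdZ. Qed.
HB.instance Definition _ := GRing.Lmodule_isLalgebra.Build R E adj_scaleAl.
Fact adj_scaleAr (a : R) (f g : E) : a *: (f * g) = f * (a *: g).
Proof. by apply: adjointP => x //=; rewrite /rscale fwdZ. Qed.
HB.instance Definition _ := GRing.Lalgebra_isAlgebra.Build R E adj_scaleAr.

Lemma adjS_involution : is_involution (adjS : E -> E).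
Proof. by split=> [f g|f g|f]; apply: adjointP. Qed.
Lemma adjSZ (c : R) (f : E) : adjS (c *: f) = c *: adjS f.
Proof. exact: adjointP. Qed.

End AdjointRing.

(** If a b = 1, multiplying a relation p(a) = 0 of degree n by b^(n - 1) writes
    a regular multiple of [a] as a polynomial in [b]; so [a] and [b] commute. *)
Lemma dedekind_finite_of_relations (R : comUnitRingType) (E : algType R) :
  (forall a : E, exists p : {poly R}, horner_alg a p = 0 /\
     forall x : E, lead_coef p *: x = 0 -> x = 0) ->
  dedekind_finite E.
Proof.
move=> rel a b ab; have [p [pa reg]] := rel a.
have abX i d : a ^+ i * b ^+ (i + d) = b ^+ d.
  elim: i => [|i IHi]; first by rewrite expr0 mul1r.
  by rewrite exprSr addSn exprS -mulrA (mulrA a) ab mul1r.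
case sp : (size p) => [|[|n]].
- by move/eqP: (oner_neq0 E); case; apply: reg; rewrite lead_coefE sp nth_default ?scale0r ?sp.
- have pE : p = (lead_coef p)%:P by rewrite lead_coefE sp; apply: size1_polyC; rewrite sp.
  move/eqP: (oner_neq0 E); case; apply: reg; move: pa.
  by rewrite {1}pE horner_algC.
pose w := - \sum_(i < n.+1) p`_i *: b ^+ (n - i).
have pw : lead_coef p *: a = w.
  move: pa; rewrite horner_algE sp big_ord_recr /= => /(congr1 (fun z => z * b ^+ n)).
  rewrite mul0r mulrDl mulr_suml -scalerAl exprS -mulrA.
  have := abX n 0%N; rewrite addn0 expr0 => ->; rewrite mulr1 addrC lead_coefE sp => /eqP.
  rewrite addr_eq0 => /eqP ->; congr (- _); apply: eq_bigr => i _.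
  have -> : b ^+ n = b ^+ (i + (n - i)) by rewrite subnKC // -ltnS.
  by rewrite -scalerAl abX.
have wb : w * b = b * w.
  rewrite mulNr mulrN mulr_suml mulr_sumr; congr (- _); apply: eq_bigr => i _.
  by rewrite -scalerAl -scalerAr -exprSr -exprS.
apply/eqP; rewrite -subr_eq0 -{1}ab; apply/eqP; apply: reg.
by rewrite scalerBr scalerAr pw scalerAl pw wb subrr.
Qed.

Section Restriction.
Variables (R : comUnitRingType) (A : algType R).

(** A copy of [M], to carry its scalar multiplication by [R]. *)
Definition restriction (M : lmodType A^c) : Type := M.
HB.instance Definition _ (M : lmodType A^c) := GRing.Zmodule.on (restriction M).

Section Scale.
Variable M : lmodType A^c.
Fact restriction_scaleA (a b : R) (v : M) : rscale a (rscale b v) = rscale (a * b) v.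
Proof. exact: rscaleA. Qed.
Fact restriction_scale1 : left_id 1 (@rscale R A M). Proof. exact: rscale1. Qed.
Fact restriction_scaleDr : right_distributive (@rscale R A M) +%R.
Proof. by move=> c x y; apply: rscaleDr. Qed.
Fact restriction_scaleDl (v : M) : {morph (@rscale R A M)^~ v : a b / a + b}.
Proof. by move=> a b; apply: rscaleDl. Qed.
HB.instance Definition _ := GRing.Zmodule_isLmodule.Build R (restriction M)
  restriction_scaleA restriction_scale1 restriction_scaleDr restriction_scaleDl.
End Scale.

Lemma rscale_scale (M : lmodType A^c) (c : R) (a : A) (z : M) :
  ((c *: a : A) : A^c) *: z = rscale c ((a : A^c) *: z).
Proof.
rewrite /rscale [RHS]scalerA; apply: (congr1 (fun b : A^c => b *: z)).
exact: esym (mulr_algr _ _).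
Qed.

Lemma fin_gen_restriction (M : lmodType A^c) : fin_gen (A : lmodType R) -> fin_gen M ->
  fin_gen (restriction M : lmodType R).
Proof.
move=> [n [g gA]] [m [y yM]].
pose T : finType := ('I_m * 'I_n)%type.
exists #|T|, (fun t => ((g (enum_val t).2 : A^c) *: y (enum_val t).1 : M)).
move=> x; have [c ->] := yM x.
have [d dE] := fin_all_exists (fun i => gA (c i)).
exists (fun t => d (enum_val t).1 (enum_val t).2).
rewrite (reindex (@enum_rank T)) /=; last by apply: onW_bij; apply: enum_rank_bij.
under [RHS]eq_bigr do rewrite enum_rankK.
rewrite -(pair_bigA _ (fun i j => d i j *: ((g j : A^c) *: y i : restriction M))) /=.
apply: eq_bigr => i _; rewrite {1}dE.
have sumE (F : 'I_n -> A) (z : M) : ((\sum_j F j : A) : A^c) *: z = \sum_j ((F j : A^c) *: z).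
  exact: scaler_suml.
rewrite sumE; apply: eq_bigr => j _.
exact: rscale_scale.
Qed.
End Restriction.

Section AdjointModule.
Variables (R : comUnitRingType) (A : algType R) (I : Type) (sigma : I -> A -> A).
Hypothesis hsigma : forall i, R_involution (sigma i).
Variables (M : lmodType A^c) (h : I -> M -> M -> A).
Hypothesis hh : forall i, sesquilinear (sigma i) (h i).
Variables (x0 : M) (x0N : x0 != 0).
Local Notation E := (adjoint hsigma hh x0N).
Local Notation MR := (restriction M : lmodType R).

Lemma fwd_sum (T : Type) (r : seq T) (P : pred T) (F : T -> E) x :
  fwd (\sum_(i <- r | P i) F i) x = \sum_(i <- r | P i) fwd (F i) x.
Proof. by apply: (big_morph (fun f : E => fwd f x)). Qed.

Lemma bwd_sum (T : Type) (r : seq T) (P : pred T) (F : T -> E) x :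
  bwd (\sum_(i <- r | P i) F i) x = \sum_(i <- r | P i) bwd (F i) x.
Proof. by apply: (big_morph (fun f : E => bwd f x)). Qed.

Lemma fwd_horner_alg (a : E) p x : fwd (horner_alg a p) x =
  \sum_(k < size p) p`_k *: (iter k (fwd a) x : restriction M).
Proof.
rewrite horner_algE fwd_sum; apply: eq_bigr => k _.
suff -> : iter k (fwd a) x = fwd (a ^+ k) x by [].
by elim: (k : nat) => //= n ->; rewrite exprS.
Qed.

Lemma bwd_horner_alg (a : E) p x : bwd (horner_alg a p) x =
  \sum_(k < size p) p`_k *: (iter k (bwd a) x : restriction M).
Proof.
rewrite horner_algE bwd_sum; apply: eq_bigr => k _.
suff -> : iter k (bwd a) x = bwd (a ^+ k) x by [].
by elim: (k : nat) => //= n ->; rewrite exprSr.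
Qed.

Section FinitelyGenerated.
Variables (N : nat) (g : 'I_N -> restriction M).
Hypothesis gM : forall x : restriction M, exists c : 'I_N -> R, x = \sum_i c i *: g i.

Let sum_fwd (a : E) (c : 'I_N -> R) : fwd a (\sum_i c i *: g i) = \sum_i c i *: (fwd a (g i) : restriction M).
Proof.
rewrite (big_morph (fwd a) (fwdD a) (fwd0 a)); apply: eq_bigr => i _.
exact: fwdZ.
Qed.

Let sum_bwd (a : E) (c : 'I_N -> R) : bwd a (\sum_i c i *: g i) = \sum_i c i *: (bwd a (g i) : restriction M).
Proof.
rewrite (big_morph (bwd a) (bwdD a) (bwd0 a)); apply: eq_bigr => i _.
exact: bwdZ.
Qed.

(** A polynomial in [a] acts through [fwd a] on one component and through
    [bwd a] on the other; each has its own characteristic polynomial. *)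
Lemma finite_relation (a : E) : exists2 p : {poly R}, p \is monic & horner_alg a p = 0.
Proof.
have [F FE] := fin_all_exists (fun i => gM (fwd a (g i))).
have [B BE] := fin_all_exists (fun i => gM (bwd a (g i))).
pose p := char_poly (\matrix_(i, j) F i j); pose q := char_poly (\matrix_(i, j) B i j).
exists (p * q); first by rewrite monicMl char_poly_monic.
have pE x : fwd (horner_alg a p) x = 0.
  have [c ->] := gM x; rewrite sum_fwd big1 // => i _.
  rewrite fwd_horner_alg (@char_poly_annihilates R (restriction M) (fwd a) _ g _ (sum_fwd a)) ?scaler0 // => j.
  by rewrite {1}FE; apply: eq_bigr => l _; rewrite mxE.
have qE x : bwd (horner_alg a q) x = 0.
  have [c ->] := gM x; rewrite sum_bwd big1 // => i _.
  rewrite bwd_horner_alg (@char_poly_annihilates R (restriction M) (bwd a) _ g _ (sum_bwd a)) ?scaler0 // => j.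
  by rewrite {1}BE; apply: eq_bigr => l _; rewrite mxE.
rewrite rmorphM /=; apply: adjointP => x /=; first by rewrite pE.
by rewrite qE.
Qed.

Variables (k : fieldType) (pi : {rmorphism R -> k}).
Hypothesis pi_onto : forall y, exists x, pi x = y.
Hypothesis pi_unit : forall x, (x \is a GRing.unit) = (pi x != 0).

(** By Nakayama's lemma, a nonzero idempotent moves some generator outside of m M,
    where m is the maximal ideal. For orthogonal idempotents these images are
    independent in M / m M, whose dimension is at most [N]. *)
Lemma finite_idempotents (f : 'I_N.+1 -> E) :
  (forall i, symmetric_idempotent (@adjS R A I sigma hsigma M h hh x0 x0N) (f i)) ->
  (forall i j, i != j -> f i * f j = 0) -> exists i, f i = 0.
Proof.
move=> fP ff; apply: contrapT => f0.
(* membership in m M *)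
pose small (y : restriction M) := exists2 c : 'I_N -> R, (forall l, pi (c l) = 0) & y = \sum_l c l *: g l.
have smallD y z : small y -> small z -> small (y + z).
  move=> [c c0 ->] [d d0 ->]; exists (fun l => c l + d l) => [l|].
    by rewrite rmorphD c0 d0 addr0.
  by rewrite -big_split; apply: eq_bigr => l _; rewrite scalerDl.
have smallZ c (y : restriction M) : pi c = 0 -> small (c *: y).
  move=> c0; have [d ->] := gM y; exists (fun l => c * d l) => [l|].
    by rewrite rmorphM c0 mul0r.
  by rewrite scaler_sumr; apply: eq_bigr => l _; rewrite scalerA.
have small0 : small 0.
  by exists (fun=> 0) => [l|]; rewrite ?rmorph0 // big1 // => l _; rewrite scale0r.
have small_sum (T : finType) (c : T -> R) (y : T -> restriction M) :
    (forall l, pi (c l) = 0) -> small (\sum_l c l *: y l).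
  by move=> c0; apply: (big_ind small) => // l _; apply: smallZ.
have small_fwd (a : E) y : small y -> small (fwd a y).
  by move=> [c c0 ->]; rewrite sum_fwd; apply: small_sum.
have fid i x : fwd (f i) (fwd (f i) x) = fwd (f i) x.
  by have [ffi _] := fP i; rewrite -{3}ffi.
have big i : exists j, ~ small (fwd (f i) (g j)).
  apply: contrapT => nob.
  have sm j : small (fwd (f i) (g j)) by apply: contrapT => nsm; apply: nob; exists j.
  apply: f0; exists i.
  have smP j : exists c : 'I_N -> R, (forall l, pi (c l) = 0) /\
      fwd (f i) (g j) = \sum_l c l *: g l.
    by have [c c0 cE] := sm j; exists c.
  have [c cP] := fin_all_exists smP.
  have fg0 j : fwd (f i) (g j) = 0 :> restriction M.
    have [||W WE] := @nakayama_solve R k pi pi_unit (restriction M) N (\matrix_(a, b) c a b) (fun j => fwd (f i) (g j)) (fun=> 0).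
    - by apply/matrixP => a b; rewrite !mxE; case: (cP a).
    - move=> a; rewrite add0r -[LHS]fid; have [_ {1}->] := cP a; rewrite sum_fwd.
      by apply: eq_bigr => l _; rewrite mxE.
    by rewrite WE big1 // => l _; rewrite scaler0.
  have fwd0' x : fwd (f i) x = 0.
    have [d ->] := gM x; rewrite sum_fwd big1 // => l _.
    by rewrite fg0 scaler0.
  apply: adjointP => x /=; first by rewrite fwd0'.
  by have [_ <-] := fP i; rewrite /= fwd0'.
have [j jP] := fin_all_exists big.
have [c cE] := fin_all_exists (fun i => gM (fwd (f i) (g (j i)))).
pose C : 'M[k]_(N.+1, N) := \matrix_(i, l) pi (c i l).
have : kermx C != 0.
  by rewrite kermx_eq0 /row_free; apply: contraTneq (rank_leq_col C) => ->; rewrite ltnn.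
case/rowV0Pn => v /sub_kermxP vC v0.
have [lam lamE] := fin_all_exists (fun i => pi_onto (v 0 i)).
have [i0 vi0] : exists i0, v 0 i0 != 0.
  apply: contrapT => nov; move/eqP: v0; apply; apply/rowP => i; rewrite mxE.
  by apply/eqP; apply: contrapT => /negP vi; apply: nov; exists i.
have sm : small (\sum_i lam i *: (fwd (f i) (g (j i)) : restriction M)).
  under eq_bigr do rewrite cE scaler_sumr.
  rewrite exchange_big /=.
  have -> : \sum_l \sum_i lam i *: (c i l *: g l) = \sum_l (\sum_i lam i * c i l) *: g l.
    by apply: eq_bigr => l _; rewrite scaler_suml; apply: eq_bigr => i _; rewrite scalerA.
  apply: small_sum => l; have := congr1 (fun m : 'rV_N => m 0 l) vC.
  rewrite !mxE rmorph_sum => {2}<-; apply: eq_bigr => i _.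
  by rewrite rmorphM lamE mxE.
apply: (jP i0); have := small_fwd (f i0) _ sm.
have -> : fwd (f i0) (\sum_i lam i *: (fwd (f i) (g (j i)) : restriction M)) =
    lam i0 *: (fwd (f i0) (g (j i0)) : restriction M).
  rewrite (big_morph (fwd (f i0)) (fwdD (f i0)) (fwd0 (f i0))) (bigD1 i0) //= big1 => [|i ii0].
    rewrite addr0; apply: etrans (fwdZ _ _ _) _.
    exact: (congr1 (rscale (lam i0)) (fid _ _)).
  apply: etrans (fwdZ _ _ _) _; rewrite -[fwd _ (fwd _ _)]/(fwd (f i0 * f i) _) ff 1?eq_sym //=.
  exact: scaler0.
have lU : lam i0 \is a GRing.unit by rewrite pi_unit lamE.
move=> [d d0 dE]; exists (fun l => (lam i0)^-1 * d l) => [l|].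
  by rewrite rmorphM d0 mulr0.
have := congr1 (fun z : restriction M => (lam i0)^-1 *: z) dE.
rewrite scalerA mulVr // scale1r => ->; rewrite scaler_sumr.
by apply: eq_bigr => l _; rewrite scalerA.
Qed.

End FinitelyGenerated.
End AdjointModule.

(** * Torsion-free algebras over a valuation ring *)

Section FractionField.
Import classical_sets.
Variables (R : comUnitRingType) (K : fieldType) (iota : {rmorphism R -> K}).
Hypothesis iota_frac : is_fraction_field iota.

Lemma iota_eq0 r : (iota r == 0) = (r == 0).
Proof. by rewrite -(rmorph0 iota) (inj_eq iota_frac.1). Qed.

Section Functional.
Variables (M : lmodType R) (x : M).
Hypotheses (tf : torsion_free M) (xN0 : x != 0).

Let submodule (N : set M) := N 0 /\ forall a y z, N y -> N z -> N (a *: y + z).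
Let avoids (N : set M) := forall r, N (r *: x) -> r = 0.

(** Let N be maximal among the submodules that meet R x in 0. By maximality each
    y satisfies s y - r x in N for some r and s <> 0, and phi y = r / s does not
    depend on the choice, as N meets R x in 0. *)
Lemma functional_exists : exists phi : M -> K,
  (forall a y z, phi (a *: y + z) = iota a * phi y + phi z) /\ phi x = 1.
Proof.
have [|||N [[N0 Nlin] Nav] Nmax] := @Zorn_maximal M (fun N => submodule N /\ avoids N) [set 0]%classic.
- split; first by split=> // a y z -> ->; rewrite scaler0 addr0.
  by move=> r rx; have [|/eqP] := tf rx => //; rewrite (negPf xN0).
- by move=> B [[B0 _] _]; exists 0.
- move=> F FQ [A FA] Ftot; split.
    split; first by exists A => //; case: (FQ A FA) => [[]].
    move=> a y z [X FX Xy] [Y FY Yz].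
    have [[[_ Xlin] _] [[_ Ylin] _]] := (FQ X FX, FQ Y FY).
    case: (Ftot X Y FX FY) => sub; first by exists Y => //; apply: Ylin => //; apply: sub.
    by exists X => //; apply: Xlin => //; apply: sub.
  by move=> r [X FX Xrx]; case: (FQ X FX) => _; apply.
have NZ a y : N y -> N (a *: y) by move=> Ny; rewrite -[_ *: _]addr0; apply: Nlin.
have ND y z : N y -> N z -> N (y + z) by move=> Ny; rewrite -[y]scale1r; apply: Nlin.
have NN y : N y -> N (- y) by rewrite -scaleN1r; apply: NZ.
have frac y : exists sr : R * R, sr.1 != 0 /\ N (sr.1 *: y - sr.2 *: x).
  have [Ny|nNy] := pselect (N y).
    by exists (1, 0); rewrite /= oner_neq0 scale1r scale0r subr0.
  pose N' := [set z | exists2 n, N n & exists a, z = n + a *: y]%classic.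
  have [N'av|] := pselect (avoids N').
    case: nNy; apply: (Nmax N'); last first.
    - by exists 0 => //; exists 1; rewrite add0r scale1r.
    - by move=> z Nz; exists z => //; exists 0; rewrite scale0r addr0.
    split=> //; split; first by exists 0 => //; exists 0; rewrite scale0r addr0.
    move=> a _ _ [n Nn [b ->]] [m Nm [c ->]]; exists (a *: n + m); first exact: Nlin.
    by exists (a * b + c); rewrite scalerDr scalerDl scalerA addrACA.
  move=> /existsNP[r] /not_implyP[[n Nn [s rE]] r0]; exists (s, r) => /=.
  split; last by rewrite rE opprD addrC subrK; apply: NN.
  apply/eqP => s0; apply: r0; apply: Nav.
  by rewrite rE s0 scale0r addr0.
have [q qP] := choice frac.
pose phi y := iota (q y).2 / iota (q y).1.
have phiE y s r : s != 0 -> N (s *: y - r *: x) -> phi y = iota r / iota s.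
  move=> s0 Nsr; have [q0 Nq] := qP y.
  suff E : s * (q y).2 = (q y).1 * r.
    apply/eqP; rewrite eqr_div ?iota_eq0 // -!rmorphM mulrC E mulrC; exact/eqP.
  apply/eqP; rewrite -subr_eq0; apply/eqP/Nav.
  have -> : (s * (q y).2 - (q y).1 * r) *: x =
      (q y).1 *: (s *: y - r *: x) - s *: ((q y).1 *: y - (q y).2 *: x).
    by rewrite !scalerBr scalerBl !scalerA [s * (q y).1]mulrC opprB [RHS]addrC addrA subrK.
  by apply: ND; [apply: NZ|apply/NN/NZ].
exists phi; split=> [a y z|]; last first.
  by rewrite (phiE x 1 1) ?oner_neq0 ?subrr // divff // iota_eq0 oner_neq0.
have [[s0 Ny] [s'0 Nz]] := (qP y, qP z); have [yE zE] := (erefl (phi y), erefl (phi z)).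
rewrite {2}/phi in yE; rewrite {2}/phi in zE; rewrite yE zE.
move: (q y) (q z) s0 Ny s'0 Nz {yE zE} => [s r] [s' r'] /= s0 Ny s'0 Nz.
rewrite (phiE _ (s * s') (a * s' * r + s * r')).
- rewrite !rmorphD !rmorphM; field; by rewrite !iota_eq0 s0 s'0.
- by rewrite -iota_eq0 rmorphM mulf_neq0 // iota_eq0.
- have -> : (s * s') *: (a *: y + z) - (a * s' * r + s * r') *: x =
      (a * s') *: (s *: y - r *: x) + s *: (s' *: z - r' *: x).
    rewrite !scalerBr scalerDr scalerDl !scalerA opprD addrACA.
    by congr (_ *: _ - _ + _); ring.
  by apply: ND; apply: NZ.
Qed.
End Functional.

(** If x <> 0, the functional with value 1 at [x] factors through [j], so [j] does
    not kill [x]. *)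
Lemma base_change_injective (M : lmodType R) (V : lmodType K)
    (j : {linear M -> V | iota \; *:%R}) :
  torsion_free M -> is_base_change j -> forall x, j x = 0 -> x = 0.
Proof.
move=> tf bc x jx; apply/eqP/negPn/negP => xN0.
have [phi [philin phix]] := functional_exists tf xN0.
have phiL : linear_for (iota \; *:%R) (phi : M -> K^o) by move=> a y z; apply: philin.
pose f : {linear M -> K^o | iota \; *:%R} := HB.pack (phi : M -> K^o) (GRing.isLinear.Build R M K^o _ phi phiL).
have [g [gE _]] := bc K^o f.
have := gE x; rewrite jx linear0 => /esym/eqP.
by rewrite -[f x]/(phi x) phix oner_eq0.
Qed.

End FractionField.

(** The form in which finite rank is used: it passes from the algebra to its
    finitely generated projective modules and to their adjoint pairs. *)
Definition coordinates (R : comUnitRingType) (K : fieldType)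
    (iota : {rmorphism R -> K}) (M : lmodType R) (X : Type) (phi : M -> X -> K) :=
  (forall a y z t, phi (a *: y + z) t = iota a * phi y t + phi z t) /\
  (forall y, (forall t, phi y t = 0) -> y = 0).

Lemma finite_rank_coordinates (R : comUnitRingType) (M : lmodType R) :
  torsion_free M -> finite_rank M ->
  exists (K : fieldType) (iota : {rmorphism R -> K}) (n : nat) (phi : M -> 'I_n -> K),
    is_fraction_field iota /\ coordinates iota phi.
Proof.
move=> tf [n [K [iota [frac [V [j [bc dV]]]]]]].
exists K, iota, (\dim {:V}), (fun x t => coord (vbasis {:V}) t (j x)); split=> //.
split=> [a y z t|y y0]; first by rewrite linearP linearP.
apply: (base_change_injective frac tf bc).
rewrite (coord_vbasis (memvf (j y))) big1 // => t _.
by rewrite y0 scale0r.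
Qed.

Section Coordinates.
Variables (R : comUnitRingType) (K : fieldType) (iota : {rmorphism R -> K}).
Hypothesis iota_frac : is_fraction_field iota.
Variables (M : lmodType R) (X : finType) (phi : M -> X -> K).
Hypothesis phiP : coordinates iota phi.

Lemma coordinates0 t : phi 0 t = 0.
Proof.
have := phiP.1 (-1) 0 0 t; rewrite scaler0 addr0 rmorphN rmorph1 mulN1r addNr.
by [].
Qed.

Lemma coordinatesZ a y t : phi (a *: y) t = iota a * phi y t.
Proof. by rewrite -[a *: y]addr0 phiP.1 coordinates0 addr0. Qed.

Lemma coordinates_torsion_free : torsion_free M.
Proof.
move=> r x rx; have [->|r0] := eqVneq r 0; [by left|right].
apply: phiP.2 => t; apply/eqP; have /eqP := coordinatesZ r x t.
by rewrite rx coordinates0 eq_sym mulf_eq0 (iota_eq0 iota_frac) (negPf r0).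
Qed.

Lemma coordinates_sum n (r : 'I_n -> R) (x : 'I_n -> M) t :
  phi (\sum_i r i *: x i) t = \sum_i iota (r i) * phi (x i) t.
Proof.
elim/big_rec2: _ => [|i y1 y2 _ <-]; first exact: coordinates0.
exact: phiP.1.
Qed.

(** Linear dependence over [K], with the denominators cleared. *)
Lemma coordinates_dependent (x : 'I_#|X|.+1 -> M) :
  exists r : 'I_#|X|.+1 -> R, (exists i, r i != 0) /\ \sum_i r i *: x i = 0.
Proof.
pose C : 'M[K]_(#|X|.+1, #|X|) := \matrix_(i, l) phi (x i) (enum_val l).
have : kermx C != 0.
  by rewrite kermx_eq0 /row_free; apply: contraTneq (rank_leq_col C) => ->; rewrite ltnn.
case/rowV0Pn => v /sub_kermxP vC v0.
have fr i : exists ab : R * R, iota ab.2 != 0 /\ v 0 i = iota ab.1 / iota ab.2.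
  by have [a [b [b0 ->]]] := iota_frac.2 (v 0 i); exists (a, b).
have [ab abP] := fin_all_exists fr.
pose r i := (ab i).1 * \prod_(j | j != i) (ab j).2.
pose d := iota (\prod_j (ab j).2).
have d0 : d != 0.
  by rewrite /d rmorph_prod; apply/prodf_neq0 => j _; case: (abP j).
have rE i : iota (r i) = d * v 0 i.
  have [b0 ->] := abP i; rewrite /d (bigD1 i) //= !rmorphM; field; exact: b0.
exists r; split.
  have [i vi] : exists i, v 0 i != 0.
    apply: contrapT => nov; move/eqP: v0; apply; apply/rowP => i; rewrite mxE.
    by apply/eqP; apply: contrapT => /negP vi; apply: nov; exists i.
  by exists i; rewrite -(iota_eq0 iota_frac) rE mulf_neq0.
apply: phiP.2 => t; rewrite coordinates_sum.
have := congr1 (fun m : 'rV_#|X| => d * m 0 (enum_rank t)) vC.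
rewrite !mxE mulr0 mulr_sumr => {2}<-; apply: eq_bigr => i _.
by rewrite rE mulrA mxE enum_rankK.
Qed.

End Coordinates.

Lemma valuation_divides (R : comUnitRingType) : valuation_ring R ->
  forall r s : R, (exists c, r = c * s) \/ (exists c, s = c * r).
Proof.
move=> [K [iota [frac val]]] r s.
have [->|s0] := eqVneq s 0; first by right; exists 0; rewrite mul0r.
have [->|r0] := eqVneq r 0; first by left; exists 0; rewrite mul0r.
have is0 : iota s != 0 by rewrite (iota_eq0 frac).
have ir0 : iota r != 0 by rewrite (iota_eq0 frac).
have [|[c cE]|[c cE]] := val (iota r / iota s); first by rewrite mulf_neq0 ?invr_neq0.
- left; exists c; apply: frac.1; by rewrite rmorphM -cE divfK.
- right; exists c; apply: frac.1; by rewrite rmorphM -cE invf_div divfK.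
Qed.

(** Divide [p] by a coefficient which divides all the others. *)
Lemma valuation_primitive (R : comUnitRingType) (p : {poly R}) :
  valuation_ring R -> p != 0 ->
  exists c q, [/\ c != 0, p = c *: q & exists i, q`_i = 1].
Proof.
move=> val p0.
have divseq (s : seq R) : s != [::] -> exists2 x, x \in s & forall y, y \in s -> exists c, y = c * x.
  elim: s => // x [|y s] IHs _.
    by exists x; rewrite ?mem_head // => z; rewrite inE => /eqP ->; exists 1; rewrite mul1r.
  have [//|z zs zP] := IHs; have [[c xc]|[c zc]] := valuation_divides val x z.
    exists z; first by rewrite inE zs orbT.
    by move=> t; rewrite inE => /orP[/eqP ->|/zP]; [exists c|].
  exists x; first exact: mem_head.
  move=> t; rewrite inE => /orP[/eqP ->|/zP[e ->]]; first by exists 1; rewrite mul1r.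
  by exists (e * c); rewrite zc mulrA.
have [|c cp cP] := divseq p; first by rewrite -size_eq0 size_poly_eq0.
have qex (i : 'I_(size p)) : exists q, p`_i = q * c by apply/cP/mem_nth.
have [q qE] := fin_all_exists qex.
have c0 : c != 0.
  apply: contra_neq p0 => c0; apply/polyP => i; rewrite coef0.
  have [ip|pi] := ltnP i (size p); last by rewrite nth_default.
  by rewrite (qE (Ordinal ip)) c0 mulr0.
pose q' := \poly_(i < size p) (if insub i is Some j then q j else 0).
exists c, q'; split=> //.
  apply/polyP => i; rewrite coefZ coef_poly; case: ltnP => [ip|pi].
    by rewrite insubT /= mulrC -(qE (Ordinal ip)).
  by rewrite mulr0 nth_default.
have [i ip ci] := nthP 0 cp; exists i; rewrite coef_poly ip insubT /=.
have [K [iota [frac _]]] := val; apply: frac.1.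
apply: (mulIf (_ : iota c != 0)); first by rewrite (iota_eq0 frac).
by rewrite rmorph1 mul1r -rmorphM -(qE (Ordinal ip)) /= ci.
Qed.

Section AlgebraCoordinates.
Variables (R : comUnitRingType) (E : algType R) (K : fieldType) (iota : {rmorphism R -> K}).
Hypothesis val : valuation_ring R.
Hypothesis iota_frac : is_fraction_field iota.
Variables (X : finType) (phi : (E : lmodType R) -> X -> K).
Hypothesis phiP : coordinates iota phi.

(** The powers of [a] are linearly dependent; dividing the relation by its
    content is possible as the algebra is torsion-free. *)
Lemma torsion_free_relation (a : E) : exists p : {poly R},
  [/\ exists i, p`_i = 1, horner_alg a p = 0 &
    forall x : E, lead_coef p *: x = 0 -> x = 0].
Proof.
have [r [[i0 ri0] rx]] := coordinates_dependent iota_frac phiP (fun i => a ^+ i).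
pose p := \poly_(i < #|X|.+1) (if insub i is Some j then r j else 0).
have pE (i : 'I_#|X|.+1) : p`_i = r i by rewrite coef_poly ltn_ord valK.
have p0 : p != 0 by apply: contra_neq ri0 => p0; rewrite -pE p0 coef0.
have pa : horner_alg a p = 0.
  rewrite horner_algE (big_ord_widen #|X|.+1 (fun i => p`_i *: a ^+ i)) ?size_poly //.
  rewrite -[RHS]rx big_mkcond; apply: eq_bigr => i _; rewrite -pE.
  by case: ltnP => // pi; rewrite nth_default ?scale0r.
have [c [q [c0 pq [i qi]]]] := valuation_primitive val p0.
have tf := coordinates_torsion_free iota_frac phiP.
exists q; split; first by exists i.
  move: pa; rewrite pq linearZ /= mulr_algl => /tf[/eqP|//].
  by rewrite (negPf c0).
move=> x /tf[/eqP|//]; rewrite lead_coef_eq0 => /eqP q0.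
by move: p0; rewrite pq q0 scaler0 eqxx.
Qed.

Lemma torsion_free_idempotents (f : 'I_#|X|.+1 -> E) :
  (forall i, f i * f i = f i) -> (forall i j, i != j -> f i * f j = 0) ->
  exists i, f i = 0.
Proof.
move=> fP ff; have [r [[i ri] rf]] := coordinates_dependent iota_frac phiP f.
exists i; have := congr1 (fun x => f i * x) rf.
rewrite mulr0 mulr_sumr (bigD1 i) //= big1 ?addr0 => [|j ji].
  rewrite -scalerAr fP => /(coordinates_torsion_free iota_frac phiP)[/eqP|//].
  by rewrite (negPf ri).
by rewrite -scalerAr ff 1?eq_sym // scaler0.
Qed.
End AlgebraCoordinates.

(** * Cancellation *)

Section Modules.
Variables (R : comUnitRingType) (A : algType R).

(** All that is used of projectivity: it carries coordinates from [A] to [M]. *)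
Definition power_embedding (M : lmodType A^c) (T : Type) (kappa : M -> T -> A) :=
  (forall c x y l, kappa (rscale c x + y) l = c *: kappa x l + kappa y l) /\
  (forall x, (forall l, kappa x l = 0) -> x = 0).

Lemma projective_embedding (M : lmodType A^c) : fin_gen M -> projective M ->
  exists n (kappa : M -> 'I_n -> A), power_embedding kappa.
Proof.
move=> [n [g gM]] prM.
pose p (v : 'rV[A^c]_n) : M := \sum_i v 0 i *: g i.
have pL : linear p.
  move=> a u v; rewrite /p scaler_sumr -big_split; apply: eq_bigr => i _ /=.
  by rewrite !mxE scalerDl scalerA.
pose pl : {linear 'rV[A^c]_n -> M} := HB.pack p (GRing.isLinear.Build A^c 'rV[A^c]_n M _ p pL).
have [|h hE] := prM 'rV[A^c]_n M pl idfun.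
  move=> y; have [c ->] := gM y; exists (\row_i c i); apply: eq_bigr => i _.
  by rewrite mxE.
exists n, (fun x l => h x 0 l); split=> [c x y l|x x0].
  rewrite /rscale linearP !mxE; congr (_ + _); exact: mulr_algr.
have -> : x = pl (h x) by rewrite hE.
have -> : h x = 0 by apply/rowP => i; rewrite mxE x0.
exact: linear0.
Qed.

Lemma fin_gen_prod (P Q : lmodType A^c) : fin_gen P -> fin_gen Q ->
  fin_gen (P * Q : lmodType A^c)%type.
Proof.
move=> [m [g gP]] [n [g' gQ]].
exists (m + n)%N, (fun i => match split i with inl a => (g a, 0) | inr b => (0, g' b) end).
move=> [x y]; have [[c ->] [d ->]] := (gP x, gQ y).
exists (fun i => match split i with inl a => c a | inr b => d b end).
rewrite big_split_ord /=.
under [X in _ = X + _]eq_bigr => i _ do rewrite (unsplitK (inl i)).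
under [X in _ = _ + X]eq_bigr => i _ do rewrite (unsplitK (inr i)).
have pairE (z w : (P * Q)%type) : z.1 = w.1 -> z.2 = w.2 -> z = w by case: z w => ? ? [? ?] /= -> ->.
apply: pairE => /=; rewrite !raddf_sum /=.
  rewrite [X in _ = _ + X]big1 ?addr0 // => i _; exact: scaler0.
rewrite [X in _ = X + _]big1 ?add0r // => i _; exact: scaler0.
Qed.

Lemma power_embedding_prod (P Q : lmodType A^c) (S T : Type) (kP : P -> S -> A) (kQ : Q -> T -> A) :
  power_embedding kP -> power_embedding kQ ->
  power_embedding (fun (z : (P * Q : lmodType A^c)%type) l =>
    match l with inl a => kP z.1 a | inr b => kQ z.2 b end).
Proof.
move=> [kPl kPi] [kQl kQi]; split=> [c [x y] [x' y'] [l|l]|[x y] xy0]; rewrite /=.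
- exact: kPl.
- exact: kQl.
- by rewrite (kPi x (fun l => xy0 (inl l))) (kQi y (fun l => xy0 (inr l))).
Qed.

End Modules.

Section AdjointWitt.
Variables (R : comUnitRingType) (A : algType R) (I : Type) (sigma : I -> A -> A).
Hypothesis hsigma : forall i, R_involution (sigma i).
Variables (M : lmodType A^c) (h : I -> M -> M -> A).
Hypothesis hh : forall i, sesquilinear (sigma i) (h i).
Variables (x0 : M) (x0N : x0 != 0).
Local Notation E := (adjoint hsigma hh x0N).

(** A pair is determined by the images of finitely many generators under its two
    components. *)
Lemma adjoint_coordinates (K : fieldType) (iota : {rmorphism R -> K}) (n : nat)
    (chi : (A : lmodType R) -> 'I_n -> K) (T : finType) (kappa : M -> T -> A) :
  coordinates iota chi -> fin_gen M -> power_embedding kappa ->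
  exists (X : finType) (phi : (E : lmodType R) -> X -> K), coordinates iota phi.
Proof.
move=> [chil chii] [m [g gM]] [kl ki].
exists ((bool * 'I_m) * (T * 'I_n))%type.
exists (fun a t => chi (kappa ((if t.1.1 then fwd a else bwd a) (g t.1.2)) t.2.1) t.2.2).
split=> [c a b [[[] i] [l t]]|a a0] /=.
- by rewrite -chil -kl.
- by rewrite -chil -kl.
have f0 (f : M -> M) : linear f -> (forall i, f (g i) = 0) -> forall x, f x = 0.
  move=> fl fg x; have [c ->] := gM x.
  pose F : {linear M -> M} := HB.pack f (GRing.isLinear.Build A^c M M _ f fl).
  rewrite -[f _]/(F _) linear_sum big1 // => i _.
  by rewrite linearZ /= fg scaler0.
apply: adjointP => x; apply: f0 => [|i].
- exact: fwd_linear.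
- apply: ki => l; apply: chii => t; exact: (a0 ((true, i), (l, t))).
- exact: bwd_linear.
- apply: ki => l; apply: chii => t; exact: (a0 ((false, i), (l, t))).
Qed.

Hypotheses (hlocal : local_ring R) (hhens : henselian R).
Hypothesis h2 : (2%:R : R) \is a GRing.unit.
Hypothesis hRA : (noetherian R /\ fin_gen (A : lmodType R)) \/
  [/\ valuation_ring R, torsion_free (A : lmodType R) & finite_rank (A : lmodType R)].
Hypothesis M_fg : fin_gen M.
Variables (T : finType) (kappa : M -> T -> A).
Hypothesis kappaP : power_embedding kappa.

(** Either hypothesis on [R] and [A] provides what the argument needs of the ring of
    adjoint pairs: primitive relations with regular leading coefficient, and a
    bound on the number of nonzero orthogonal symmetric idempotents. *)
Theorem adjoint_witt_extension (e : E) :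
  symmetric_idempotent (@adjS _ _ _ _ hsigma _ _ hh _ x0N) e ->
  witt_extension (@adjS _ _ _ _ hsigma _ _ hh _ x0N) e.
Proof.
have [k [pi [pi_onto pi_unit pi_hensel]]] := henselian_residue_field hlocal hhens.
have hens := hensel_factor pi_onto pi_unit pi_hensel.
have [rel [l bound]] : (forall a : E, exists p : {poly R}, [/\ map_poly pi p != 0,
      horner_alg a p = 0 & forall x : E, lead_coef p *: x = 0 -> x = 0]) /\
    exists l, forall f : 'I_l -> E,
      (forall i, symmetric_idempotent (@adjS _ _ _ _ hsigma _ _ hh _ x0N) (f i)) ->
      (forall i j, i != j -> f i * f j = 0) -> exists i, f i = 0.
  case: hRA => [[_ Afg]|[val tf fr]].
    have [N [g gM]] := fin_gen_restriction Afg M_fg.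
    split=> [a|]; last by exists N.+1; apply: (finite_idempotents gM pi_onto pi_unit).
    have [p pM pa] := finite_relation gM a; exists p; split=> //.
      by apply: monic_neq0; apply: monic_map.
    by move=> x; rewrite (monicP pM) scale1r.
  have [K [iota [n [chi [frac chiP]]]]] := finite_rank_coordinates tf fr.
  have [X [phi phiP]] := adjoint_coordinates chiP M_fg kappaP.
  split=> [a|]; last first.
    exists #|X|.+1 => f fP; apply: (torsion_free_idempotents frac phiP) => i.
    by case: (fP i).
  have [p [[i pi1] pa reg]] := torsion_free_relation val frac phiP a.
  exists p; split=> //; apply/eqP => /(congr1 (fun q : {poly k} => q`_i)).
  by rewrite coef_map pi1 /= rmorph1 coef0 => /eqP; rewrite oner_eq0.
apply: (symmetric_idempotent_witt (adjS_involution _ _ _) _ h2 _ _ bound).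
- exact: adjSZ.
- by apply: dedekind_finite_of_relations => a; have [p [_ pa reg]] := rel a; exists p.
- move=> a; have [p [p0 pa _]] := rel a.
  exact: (primitive_splitting pi_onto pi_unit hens p0 pa).
Qed.

End AdjointWitt.

Section Cancellation.
Variables (A : pzRingType) (I : Type) (sigma : I -> A -> A).
Variables (P Q Q' : lmodType A^c).
Variables (s : I -> P -> P -> A) (t : I -> Q -> Q -> A) (t' : I -> Q' -> Q' -> A).
Hypothesis hs : forall i, sesquilinear (sigma i) (s i).

Lemma sesquilinear_zero (M : lmodType A^c) (h : M -> M -> A) (sg : A -> A) :
  sesquilinear sg h -> (forall y, h 0 y = 0) /\ (forall x, h x 0 = 0).
Proof.
move=> [hl hr _]; split=> [y|x].
  by apply: (addrI (h 0 y)); rewrite -hl !addr0.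
by apply: (addrI (h x 0)); rewrite -hr !addr0.
Qed.

Lemma sesquilinear_orth_sum (hq : forall i, sesquilinear (sigma i) (t i)) i :
  sesquilinear (sigma i) (orth_sum s t i).
Proof.
have [[sl sr sZ] [tl tr tZ]] := (hs i, hq i); split=> [x x' y|x y y'|x y a b]; rewrite /orth_sum /=.
- by rewrite sl tl addrACA.
- by rewrite sr tr addrACA.
- by rewrite sZ tZ mulrDr mulrDl.
Qed.

Lemma isometry_restrict (F : {linear (P * Q)%type -> (P * Q')%type})
    (G : (P * Q')%type -> (P * Q)%type) :
  cancel F G -> cancel G F ->
  (forall i x y, orth_sum s t' i (F x) (F y) = orth_sum s t i x y) ->
  (forall q, (F (0, q)).1 = 0) -> (forall q, (G (0, q)).1 = 0) ->
  isometric t t'.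
Proof.
move=> FG GF Fiso F1 G1; pose phi q := (F (0, q)).2.
have phiL : linear phi.
  move=> a x y; rewrite /phi; have -> : (0, a *: x + y) = a *: (0, x) + (0, y) :> (P * Q)%type.
    by congr pair; rewrite /= scaler0 addr0.
  by rewrite linearP.
pose f : {linear Q -> Q'} := HB.pack phi (GRing.isLinear.Build A^c Q Q' _ phi phiL).
have FE q : F (0, q) = (0, phi q) by rewrite [LHS]surjective_pairing F1.
have GE q : G (0, q) = (0, (G (0, q)).2) by rewrite [LHS]surjective_pairing G1.
exists f; split.
  exists (fun q => (G (0, q)).2) => q; first by rewrite -[f q]/(phi q) -FE FG.
  by rewrite -[f _]/(phi _) /phi -GE GF.
move=> i x y; rewrite -[f x]/(phi x) -[f y]/(phi y).
have := Fiso i (0, x) (0, y); rewrite !FE /orth_sum /=.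
by have [s0 _] := sesquilinear_zero (hs i); rewrite !s0 !add0r.
Qed.

End Cancellation.

Theorem corollary4p17 (R : comUnitRingType) (A : algType R)
  (I : Type) (sigma : I -> A -> A)
  (hsigma : forall i, R_involution (sigma i))
  (hlocal : local_ring R) (hhens : henselian R)
  (h2 : (2%:R : R) \is a GRing.unit)
  (hRA : (noetherian R /\ fin_gen (A : lmodType R)) \/
         [/\ valuation_ring R, torsion_free (A : lmodType R)
           & finite_rank (A : lmodType R)])
  (P Q Q' : lmodType A^c)
  (s : I -> P -> P -> A) (t : I -> Q -> Q -> A) (t' : I -> Q' -> Q' -> A)
  (hs : sesq_system sigma s) (ht : sesq_system sigma t)
  (ht' : sesq_system sigma t') :
  isometric (orth_sum s t) (orth_sum s t') -> isometric t t'.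
Proof.
move=> [psi [[psi' psiK psi'K] psi_iso]].
have [[Pfg Ppr hsP] [Qfg Qpr hsQ]] := (hs, ht).
pose M : lmodType A^c := (P * Q)%type.
have hh := sesquilinear_orth_sum hsP hsQ.
have [M0|[x0 x0N]] : (forall x : M, x = 0) \/ exists x : M, x != 0.
  have [?|nex] := pselect (exists x : M, x != 0); [by right|left => x].
  by apply/eqP; apply: contrapT => /negP x0; apply: nex; exists x.
- apply: (isometry_restrict hsP psiK psi'K psi_iso) => q; last by rewrite [psi' _]M0.
  by rewrite [(0, q)]M0 linear0.
have [nP [kP kPP]] := projective_embedding Pfg Ppr.
have [nQ [kQ kQQ]] := projective_embedding Qfg Qpr.
have Mfg := fin_gen_prod Pfg Qfg.
have W := adjoint_witt_extension hlocal hhens h2 hRA Mfg (power_embedding_prod kPP kQQ)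
  (hsigma := hsigma) (hh := hh) (x0N := x0N).
pose E := adjoint hsigma hh x0N.
have psi'_lin : linear psi'.
  by move=> a x y; apply: (can_inj psiK); rewrite linearP !psi'K.
pose prM (z : M) : M := (z.1, 0).
have prM_lin : linear prM.
  by move=> a x y; congr pair; rewrite /= ?scaler0 ?addr0.
pose u1 (z : M) : M := psi' (z.1, 0); pose u2 (z : M) : M := ((psi z).1, 0).
have s0 i := (sesquilinear_zero (hsP i)).1; have s0' i := (sesquilinear_zero (hsP i)).2.
have q0 i := (sesquilinear_zero (hsQ i)).1; have q0' i := (sesquilinear_zero (hsQ i)).2.
have q'0 i := (sesquilinear_zero (let: And3 _ _ h := ht' in h i)).1.
have q'0' i := (sesquilinear_zero (let: And3 _ _ h := ht' in h i)).2.
have u1_lin : linear u1.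
  move=> a x y; rewrite /u1 -psi'_lin; congr psi'; congr pair; by rewrite /= ?scaler0 ?addr0.
have u2_lin : linear u2.
  by move=> a x y; rewrite /u2 linearP; congr pair; rewrite /= ?scaler0 ?addr0.
have psi'_iso i x y : orth_sum s t i (psi' x) (psi' y) = orth_sum s t' i x y.
  by rewrite -psi_iso !psi'K.
have pr_adj i x y : orth_sum s t i (prM x) y = orth_sum s t i x (prM y).
  by rewrite /orth_sum /= q0 q0'.
have u_adj i x y : orth_sum s t i (u1 x) y = orth_sum s t i x (u2 y).
  have -> : orth_sum s t i (u1 x) y = orth_sum s t' i (x.1, 0) (psi y).
    by rewrite -psi'_iso psiK.
  by rewrite /orth_sum /= q'0 q0'.
have u_adj' i x y : orth_sum s t i (u2 x) y = orth_sum s t i x (u1 y).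
  have -> : orth_sum s t i x (u1 y) = orth_sum s t' i (psi x) (y.1, 0).
    by rewrite -psi'_iso psiK.
  by rewrite /orth_sum /= q'0' q0.
(* the partial isometry u embeds P in P + Q as psi^-1 embeds it in the other sum *)
pose e : E := Adjoint hsigma hh x0N prM_lin prM_lin pr_adj pr_adj.
pose u : E := Adjoint hsigma hh x0N u1_lin u2_lin u_adj u_adj'.
have eP : symmetric_idempotent (@adjS _ _ _ _ hsigma _ _ hh _ x0N) e.
  by split; apply: adjointP.
have uu : adjS u * u = e.
  by apply: adjointP => x /=; rewrite /u1 /u2 psi'K.
have ue : u * e = u by apply: adjointP.
have [tau [[tau1 tau2] taue _]] := W e eP u uu ue.
have tauK : cancel (fwd tau) (bwd tau).
  by move=> x; have := congr1 (fun f : E => fwd f x) tau1.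
have tauK' : cancel (bwd tau) (fwd tau).
  by move=> x; have := congr1 (fun f : E => fwd f x) tau2.
(* the adjoint of tau e = u: the composite psi tau preserves the component in P *)
have taue2 (x : M) : (bwd tau x).1 = (psi x).1.
  by have := congr1 (fun f : E => (bwd f x).1) taue.
pose F0 (z : (P * Q)%type) : (P * Q')%type := psi (fwd tau z).
have F0L : linear F0 by move=> a x y; rewrite /F0 fwd_linear linearP.
pose F : {linear (P * Q)%type -> (P * Q')%type} := HB.pack F0 (GRing.isLinear.Build A^c _ _ _ F0 F0L).
apply: (@isometry_restrict A I sigma P Q Q' s t t' hsP F (fun z => bwd tau (psi' z))).
- by move=> z; rewrite /= /F0 psiK tauK.
- by move=> z; rewrite /= /F0 tauK' psi'K.
- by move=> i x y; rewrite /= /F0 psi_iso fwd_bwd tauK.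
- by move=> q; rewrite /= /F0 -taue2 tauK.
- by move=> q; rewrite taue2 psi'K.
Qed.
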